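(* Let $\psi$ be a Minkowski norm and $\phi$ a positively $1$-homogeneous function on $\mathbb{R}^n$, and let $\Omega\subset\mathbb{R}^n$ be a strictly convex connected domain containing the origin $\mathbf 0$. Then there exists at most one Finsler metric $F$ on $\Omega$ such that $(\Omega,F)$ is a forward complete projectively flat Finsler manifold of constant (non-positive) flag curvature with $$\psi(y)=F(\mathbf 0,y),\qquad \phi(y)=P(\mathbf 0,y),\quad\forall y\in\mathbb{R}^n,$$ where $P$ is the projective factor of $F$.
   Context: Throughout $n\ge 2$; $T\Omega$ is identified with $\Omega\times\mathbb{R}^n$ with coordinates $(x^i,y^i)$; subscripts $x^i,y^i$ denote partial derivatives and repeated indices are summed. A function $\phi$ is positively $1$-homogeneous if $\phi(\alpha y)=\alpha\phi(y)$ for all $\alpha>0$. A Minkowski norm on $\mathbb{R}^n$ is a positively $1$-homogeneous function $\psi\ge0$, vanishing only at $\mathbf 0$, smooth on $\mathbb{R}^n\setminus\{\mathbf 0\}$, such that $([\psi^2]_{y^iy^j}(y))$ is positive definite for every $y\neq\mathbf 0$. A Finsler metric on $\Omega$ is a function $F$ on $T\Omega$, smooth on $T\Omega\setminus\{0\}$, with $F(x,\cdot)$ a Minkowski norm for each $x$. Geodesics are the constant-speed curves satisfying $\ddot\gamma^i+2G^i(\gamma,\dot\gamma)=0$, $G^i=\frac14 g^{ij}\{[F^2]_{x^ky^j}y^k-[F^2]_{x^j}\}$, with $(g^{ij})$ the inverse of $g_{ij}=\frac12[F^2]_{y^iy^j}$. $(\Omega,F)$ is forward complete if every geodesic can be extended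 to parameter $+\infty$. $F$ is projectively flat if the images of all geodesics are straight lines; equivalently $G^i=Py^i$ with $P=\frac{y^kF_{x^k}}{2F}$ (the projective factor). The flag curvature $\mathbf K$ is the Finsler generalization of sectional curvature; for projectively flat $F$, $\mathbf K=\frac{P^2-y^iP_{x^i}}{F^2}$. *)

(* Defs.v *)
From HB Require Import structures.
From mathcomp Require Import all_boot all_order all_algebra.
From mathcomp Require Import all_classical all_reals all_analysis.
Set Implicit Arguments.
Unset Strict Implicit.
Unset Printing Implicit Defensive.
Import Order.TTheory GRing.Theory Num.Theory.
Import numFieldNormedType.Exports.
Local Open Scope classical_set_scope.
Local Open Scope ring_scope.

(* C^oo on an open set U: all iterated directional derivatives exist and are
   continuous at every point of U. *)
Section Smooth.
Context {R : realType} {V : normedModType R}.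

Fixpoint iter_derive (vs : seq V) (f : V -> R) : V -> R :=
  if vs is v :: vs' then 'D_v (iter_derive vs' f) else f.

Definition smooth_on (U : set V) (f : V -> R) : Prop :=
  forall (vs : seq V) (p : V), U p ->
    {for p, continuous (iter_derive vs f)} /\
    forall v : V, derivable (iter_derive vs f) p v.

End Smooth.

Section Finsler.
Context {R : realType} {n : nat}.
Local Notation V := 'rV[R]_n.

Definition ebase (i : 'I_n) : V := delta_mx 0 i.

Definition strictly_convex (Omega : set V) : Prop :=
  forall p q : V, closure Omega p -> closure Omega q -> p != q ->
  forall t : R, 0 < t < 1 -> (interior Omega) ((1 - t) *: p + t *: q).

Definition pos_homogeneous1 (phi : V -> R) : Prop :=
  forall (a : R) (y : V), 0 < a -> phi (a *: y) = a * phi y.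

Definition bilin (A : 'M[R]_n) (v w : V) : R := (v *m A *m w^T) 0 0.

Definition posdef (A : 'M[R]_n) : Prop :=
  forall v : V, v != 0 -> 0 < bilin A v v.

Definition hessian (f : V -> R) (y : V) : 'M[R]_n :=
  \matrix_(i, j) 'D_(ebase j) ('D_(ebase i) f) y.

Definition minkowski_norm (psi : V -> R) : Prop :=
  [/\ pos_homogeneous1 psi,
      forall y, 0 <= psi y,
      forall y, psi y = 0 <-> y = 0,
      smooth_on [set y | y != 0] psi
    & forall y, y != 0 -> posdef (hessian (fun z => psi z ^+ 2) y)].

(* A point of the tangent bundle is a pair p = (x, y). Functions on T Omega
   are total functions on V * V; only their values over Omega matter. *)
Definition slit (Omega : set V) : set (V * V) :=
  [set p | Omega p.1 /\ p.2 != 0].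

Definition finsler_metric (Omega : set V) (F : V * V -> R) : Prop :=
  smooth_on (slit Omega) F /\
  forall x, Omega x -> minkowski_norm (fun y => F (x, y)).

Definition dx (i : 'I_n) (f : V * V -> R) : V * V -> R := 'D_(ebase i, 0) f.
Definition dy (i : 'I_n) (f : V * V -> R) : V * V -> R := 'D_(0, ebase i) f.

Definition sqF (F : V * V -> R) : V * V -> R := fun p => F p ^+ 2.

Definition gmx (F : V * V -> R) (p : V * V) : 'M[R]_n :=
  \matrix_(i, j) (2^-1 * dy j (dy i (sqF F)) p).

Definition spray_coef (F : V * V -> R) (i : 'I_n) (p : V * V) : R :=
  4^-1 * \sum_j invmx (gmx F p) i j *
    (\sum_k dy j (dx k (sqF F)) p * p.2 0 k - dx j (sqF F) p).

Definition spray (F : V * V -> R) (p : V * V) : V :=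
  \row_i spray_coef F i p.

(* Geodesics are regular (nonconstant) curves on nonempty open intervals. *)
Definition geodesic (Omega : set V) (F : V * V -> R)
    (I : set R) (c : R -> V) : Prop :=
  [/\ [/\ I !=set0, open I & is_interval I],
      forall t, I t -> Omega (c t),
      forall t, I t -> derivable c t 1 /\ derivable (derive1 c) t 1,
      exists2 s : R, 0 < s & forall t, I t -> F (c t, derive1 c t) = s
    & forall t, I t -> derive1 (derive1 c) t + 2 *: spray F (c t, derive1 c t) = 0].

Definition forward_complete (Omega : set V) (F : V * V -> R) : Prop :=
  forall (I : set R) (c : R -> V), geodesic Omega F I c ->
  exists2 c' : R -> V, forall t, I t -> c' t = c t &
    geodesic Omega F [set t | exists2 s, I s & s <= t] c'.

Definition projectively_flat (Omega : set V) (F : V * V -> R) : Prop :=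
  forall (I : set R) (c : R -> V), geodesic Omega F I c ->
  exists a v : V, v != 0 /\ forall t, I t -> exists r : R, c t = a + r *: v.

Definition proj_factor (F : V * V -> R) (p : V * V) : R :=
  (\sum_k p.2 0 k * dx k F p) / (2 * F p).

(* Berwald's formula for the Riemann curvature of the spray:
   R^i_k = 2 G^i_{x^k} - y^j G^i_{x^j y^k} + 2 G^j G^i_{y^j y^k}
           - G^i_{y^j} G^j_{y^k}. *)
Definition riemann_mx (F : V * V -> R) (p : V * V) : 'M[R]_n :=
  let G := spray_coef F in
  \matrix_(i, k) (2 * dx k (G i) p
    - \sum_j p.2 0 j * dy k (dx j (G i)) p
    + 2 * \sum_j G j p * dy k (dy j (G i)) p
    - \sum_j dy j (G i) p * dy k (G j) p).

(* Flag curvature with flagpole y and flag span(y, u):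
   K = g_y(R_y(u), u) / (g_y(y, y) g_y(u, u) - g_y(y, u)^2),
   where R_y(u)^i = R^i_k u^k. *)
Definition flag_curvature (F : V * V -> R) (x y u : V) : R :=
  let g := bilin (gmx F (x, y)) in
  g (u *m (riemann_mx F (x, y))^T) u / (g y y * g u u - g y u ^+ 2).

Definition constant_flag_curvature (Omega : set V) (F : V * V -> R)
    (lambda : R) : Prop :=
  forall x y u : V, Omega x -> row_free (col_mx y u) ->
    flag_curvature F x y u = lambda.

End Finsler.

(* Main.v *)
Require Import Defs.
From HB Require Import structures.
From mathcomp Require Import all_boot all_order all_algebra.
From mathcomp Require Import all_classical all_reals all_analysis.
From mathcomp Require Import ring lra.
Set Implicit Arguments.
Unset Strict Implicit.
Unset Printing Implicit Defensive.
Import Order.TTheory GRing.Theory Num.Theory.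
Import numFieldNormedType.Exports.
Local Open Scope classical_set_scope.
Local Open Scope ring_scope.

(** Write P for the projective factor and lambda = - mu^2. Constant curvature turns
    Hamel's equations into two copies of the Burgers equation: for s = mu and
    s = - mu the function f = P + s F satisfies f_{x^k} = f f_{y^k}. Solutions are
    constant along straight lines (t x, z - t c x), c being the constant value, so
    f is determined by its values at the origin, and hence so are P and mu F. For
    mu = 0 the metric itself is recovered from a linear ODE along the same lines.

    The value of mu is forced by completeness: along a ray from the origin
    f = f0 / (1 - r f0) at r y, and a complete unit speed geodesic rho(t) y from the origin
    has rho' = (1 - a rho)(1 - b rho), a and b being the values P + mu F and P - mu F
    at (0, y). If another admissible metric had a larger value a' of P + mu' F, then
    (1 - a' rho)/(1 - a rho) would stay positive with derivative at most a - a' < 0.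

    Projective flatness is a statement about geodesics, so it yields the pointwise
    equations only through the local existence of geodesics in every direction. *)

(** * Derivatives along lines, symmetry of second derivatives *)

Section LineCalculus.
Context {R : realType} {V : normedModType R}.
Implicit Types (f g : V -> R) (p v w : V) (U : set V).

(** A spray of the form [P y^i] has Riemann curvature [xi] times the identity plus a matrix
    [y^i tau_k]; a flag edge orthogonal to [y] isolates [xi = P^2 - y^k P_{x^k}], and constant
    curvature says [xi = lambda F^2]. Combined with [F_{x^k} = (P F)_{y^k}] this gives the base
    derivatives of [P]. The sign [lambda <= 0] keeps both speeds [P + s F] real. The dimension bound
    serves twice: it provides the orthogonal flag edge, and it makes directions not parallel to [x]
    dense; for those the characteristic line is certain to stay off the zero section, where [F] is
    not assumed smooth. The comparison of curvatures rests on the common domain: a speed of the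
    second metric cannot blow up at a point of [Omega], hence [1 - a' rho] stays positive along a
    ray that is complete for the first. Smoothness is given by iterated directional derivatives
    alone, so additivity in the direction, symmetry of mixed derivatives and the chain rule along
    curves are derived from mean value arguments. *)

Lemma is_derive_line f p v (s : R) : derivable f (p + s *: v) v ->
  is_derive s 1 (fun t => f (p + t *: v)) ('D_v f (p + s *: v)).
Proof.
move=> fv.
have E : (fun h : R => h^-1 *: (((fun t => f (p + t *: v)) \o shift s) (h *: (1 : R))
     - f (p + s *: v))) =
   (fun h : R => h^-1 *: ((f \o shift (p + s *: v)) (h *: v) - f (p + s *: v))).
  apply/funext => h /=; congr (_ *: (f _ - _)).
  by rewrite scalerDl addrCA [h *: 1]mulr1.
by split; rewrite /derivable /derive E.
Qed.

Lemma mvt_line f p v (s : R) : 0 <= s ->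
  (forall t, 0 <= t <= s -> derivable f (p + t *: v) v) ->
  exists2 t, 0 <= t <= s & f (p + s *: v) - f p = s * 'D_v f (p + t *: v).
Proof.
move=> s0 df.
have dl t : 0 <= t <= s ->
    is_derive t 1 (fun t => f (p + t *: v)) ('D_v f (p + t *: v)).
  by move=> /df; exact: is_derive_line.
have [t|t|t] := @MVT_segment R (fun t => f (p + t *: v))
  (fun t => 'D_v f (p + t *: v)) 0 s s0.
- rewrite in_itv/= => /andP[t0 ts]; apply: dl; by rewrite !ltW.
- apply: (@derivable_within_continuous _ _ _ `[0, s]) t => t.
  by rewrite in_itv/= => /dl[].
- rewrite in_itv/= scale0r addr0 subr0 mulrC => ts E.
  by exists t.
Qed.

(** The restriction of [f] to the line, composed with [t |-> a * t], has the same difference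
    quotients as [f] in direction [a *: v]; the one-variable chain rule then covers [a = 0] as
    well. *)
Lemma is_derive_scale f p v (a : R) : derivable f p v ->
  is_derive p (a *: v) f (a * 'D_v f p).
Proof.
move=> df.
have df0 : derivable f (p + 0 *: v) v by rewrite scale0r addr0.
have d0 : is_derive (a * 0) 1 (fun t => f (p + t *: v)) ('D_v f p).
  by rewrite mulr0 -[p in 'D_v f p]addr0 -(scale0r v); exact: is_derive_line.
have da : is_derive (0 : R) 1 (fun t : R => a * t) a.
  have := @is_deriveZ R R R (fun t : R => t) a (0 : R) 1 1 _.
  by rewrite /GRing.scale/= mulr1; apply.
have [c1 c2] := is_derive1_comp d0 da.
have E : (fun h : R => h^-1 *:
    ((((fun t => f (p + t *: v)) \o (fun t : R => a * t)) \o shift 0) (h *: (1 : R))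
     - ((fun t => f (p + t *: v)) \o (fun t : R => a * t)) 0)) =
   (fun h : R => h^-1 *: ((f \o shift p) (h *: (a *: v)) - f p)).
  apply/funext => h /=; rewrite mulr0 scale0r !addr0.
  congr (_ *: (f _ - _)).
  by rewrite [h *: 1]mulr1 addrC scalerA mulrC.
by split; [move: c1; rewrite /derivable E | move: c2; rewrite /derive E mulrC].
Qed.

Lemma deriveZv f p v (a : R) : derivable f p v -> 'D_(a *: v) f p = a * 'D_v f p.
Proof. by move=> /(@is_derive_scale f p v a) []. Qed.

Lemma continuous_distP f p : {for p, continuous f} <->
  forall e : R, 0 < e -> exists2 r : R, 0 < r &
    forall q, `|q - p| < r -> `|f q - f p| < e.
Proof.
split.
  move=> cf e e0; have /nbhs_normP[r r0 Hr] : \forall q \near p, `|f q - f p| < e.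
    exact: cvgr_distC_lt cf _ e0.
  exists r => // q qp.
  by apply: Hr; rewrite /= distrC.
move=> H; apply/cvgrPdist_lt => e e0; have [r r0 Hr] := H e e0.
apply/nbhs_normP; exists r => // q /= qp; rewrite distrC; apply: Hr.
by rewrite distrC.
Qed.

Lemma open_distP U p : open U -> U p ->
  exists2 r : R, 0 < r & forall q, `|q - p| < r -> U q.
Proof.
move=> oU Up; have /nbhs_normP[r r0 Hr] := open_nbhs_nbhs (conj oU Up).
by exists r => // q qp; apply: Hr; rewrite /= distrC.
Qed.

(** The derivative is taken innermost, whereas [iter_derive] adds it outermost: with this nesting
    the product and inverse rules go through by induction on the order. *)
Fixpoint Ck (k : nat) U f : Prop :=
  (forall p, U p -> {for p, continuous f}) /\
  if k is k'.+1 then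
    (forall p v, U p -> derivable f p v) /\ (forall v, Ck k' U ('D_v f))
  else True.

(** Directional derivatives need not be additive in the direction; their continuity near [p] makes
    them so. The increment is split into a step along [v] and one along [w], and the mean value
    theorem on each gives a derivative within [e / 2] of its value at [p]. *)
Lemma is_derive_add f U p v w : open U -> U p -> Ck 1 U f ->
  is_derive p (v + w) f ('D_v f p + 'D_w f p).
Proof.
move=> oU Up [_ [df cdf]].
suff H : h^-1 *: ((f \o shift p) (h *: (v + w)) - f p) @[h --> 0^'] -->
    'D_v f p + 'D_w f p.
  by split; [apply/cvg_ex; exists ('D_v f p + 'D_w f p)|apply/cvg_lim].
apply/cvgrPdist_lt => e e0.
have e20 : 0 < e / 2 by rewrite divr_gt0.
have /continuous_distP/(_ _ e20)[r1 r10 H1] := (cdf v).1 p Up.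
have /continuous_distP/(_ _ e20)[r2 r20 H2] := (cdf w).1 p Up.
have [r3 r30 H3] := open_distP oU Up.
pose r := Num.min r1 (Num.min r2 r3).
have r0 : 0 < r by rewrite !lt_min r10 r20 r30.
pose d := r / (`|v| + `|w| + 1).
have K0 : 0 < `|v| + `|w| + 1 by rewrite ltr_wpDl// addr_ge0.
have d0 : 0 < d by rewrite divr_gt0.
have near_r (a b : R) : `|a| < d -> `|b| < d -> `|p + a *: v + b *: w - p| < r.
  move=> ad bd; rewrite -[p + _ + _]addrA [p + _]addrC addrK.
  apply: (le_lt_trans (ler_normD _ _)); rewrite !normrZ.
  apply: (@le_lt_trans _ _ (d * (`|v| + `|w|))).
    by rewrite mulrDr lerD// ler_wpM2r// ltW.
  by rewrite /d mulrAC ltr_pdivrMr// ltr_pM2l// ltrDl.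
have pos (h : R) : 0 < `|h| -> `|h| < d ->
   `|'D_v f p + 'D_w f p - h^-1 * (f (p + h *: v + h *: w) - f p)| < e.
  move=> h0 hd.
  have step (q u : V) (r' : R) : (forall t, `|t| <= `|h| -> U (q + t *: u)) ->
     (forall t, `|t| <= `|h| -> `|'D_u f (q + t *: u) - r'| < e / 2) ->
     `|r' - h^-1 * (f (q + h *: u) - f q)| < e / 2.
    move=> qU qe.
    have [hp|hn] := ltP 0 h.
      have ht t : 0 <= t <= h -> `|t| <= `|h|.
        by move=> /andP[t0 th]; rewrite !ger0_norm// ltW.
      have [|t ths ->] := @mvt_line f q u h (ltW hp).
        by move=> t /ht /qU; exact: df.
      by rewrite mulKf ?gt_eqF// distrC; apply/qe/ht.
    (* [mvt_line] needs a nonnegative length, so for negative [h] the segment is run backwards from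
       [q + h *: u]. *)
    have hn0 : h != 0 by rewrite -normr_gt0.
    have hp : 0 <= - h by rewrite oppr_ge0.
    have ht t : 0 <= t <= - h -> `|h + t| <= `|h|.
      by move=> /andP[t0 th]; rewrite !ler0_norm//; lra.
    have [|t ths] := @mvt_line f (q + h *: u) u (- h) hp.
      by move=> t /ht /qU; rewrite scalerDl addrA; exact: df.
    rewrite scaleNr addrK -addrA -scalerDl => E.
    rewrite -[f (q + h *: u) - f q]opprB E mulNr opprK mulKf// distrC.
    by apply/qe/ht.
  have h0d : `|(0 : R)| < d by rewrite normr0.
  have S1 := step p v ('D_v f p).
  have S2 := step (p + h *: v) w ('D_w f p).
  have -> : 'D_v f p + 'D_w f p - h^-1 * (f (p + h *: v + h *: w) - f p) =
    ('D_v f p - h^-1 * (f (p + h *: v) - f p)) +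
    ('D_w f p - h^-1 * (f (p + h *: v + h *: w) - f (p + h *: v))) by lra.
  rewrite (le_lt_trans (ler_normD _ _))// [ltRHS](splitr e) ltrD//.
    apply: S1 => t th.
      apply: H3; have := near_r t 0 (le_lt_trans th hd) h0d.
      by rewrite scale0r addr0 !lt_min => /and3P[].
    apply: H1; have := near_r t 0 (le_lt_trans th hd) h0d.
    by rewrite scale0r addr0 !lt_min => /and3P[].
  apply: S2 => t th.
    apply: H3; have := near_r h t hd (le_lt_trans th hd).
    by rewrite !lt_min => /and3P[].
  apply: H2; have := near_r h t hd (le_lt_trans th hd).
  by rewrite !lt_min => /and3P[].
near=> h.
have -> : (f \o shift p) (h *: (v + w)) = f (p + h *: v + h *: w).
  by rewrite /= scalerDr addrC addrA.
apply: pos; first by rewrite normr_gt0; near: h; exact: nbhs_dnbhs_neq.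
by near: h; exact: dnbhs0_lt.
Unshelve. all: by end_near. Qed.

Lemma deriveDv f U p v w : open U -> U p -> Ck 1 U f ->
  'D_(v + w) f p = 'D_v f p + 'D_w f p.
Proof. by move=> oU Up /(is_derive_add v w oU Up) []. Qed.

(** The mean value theorem is applied along [v] to the difference of [f] in [w], and then along [w].
    The left side is symmetric in [v] and [w] while the right side is not, which is what the
    symmetry of mixed derivatives exploits. *)
Lemma second_difference f U p v w (r : R) : open U -> Ck 2 U f ->
  (forall q, `|q - p| < r -> U q) ->
  forall s : R, 0 <= s -> s * (`|v| + `|w|) < r ->
  exists2 q, `|q - p| < r &
    f (p + s *: v + s *: w) - f (p + s *: v) - f (p + s *: w) + f p =
    s ^+ 2 * 'D_w ('D_v f) q.
Proof.
move=> oU [_ [df cdf]] rU s s0 sr.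
have near_r (a b : R) : 0 <= a <= s -> 0 <= b <= s ->
    `|p + a *: v + b *: w - p| < r.
  move=> /andP[a0 ad] /andP[b0 bd]; rewrite -[p + _ + _]addrA [p + _]addrC addrK.
  apply: (le_lt_trans (ler_normD _ _)); rewrite !normrZ.
  apply: le_lt_trans sr; rewrite mulrDr !ger0_norm// lerD// ler_wpM2r//.
have s00 : 0 <= (0 : R) <= s by rewrite lexx s0.
have ss : 0 <= s <= s by rewrite lexx s0.
pose g q := f (q + s *: w) - f q.
have gd t : 0 <= t <= s -> is_derive (p + t *: v) v g
   ('D_v f (p + t *: v + s *: w) - 'D_v f (p + t *: v)).
  move=> ts; apply: is_deriveB; last first.
    apply/derivableP/df/rU; have := near_r t 0 ts s00.
    by rewrite scale0r addr0.
  have D : derivable f (p + t *: v + s *: w) v.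
    by apply/df/rU; exact: near_r.
  have E : (fun h : R => h^-1 *: (((fun q => f (q + s *: w)) \o shift (p + t *: v)) (h *: v)
       - f (p + t *: v + s *: w))) =
     (fun h : R => h^-1 *: ((f \o shift (p + t *: v + s *: w)) (h *: v)
       - f (p + t *: v + s *: w))).
    by apply/funext => h /=; rewrite !addrA.
  by split; rewrite /derivable /derive E.
have [|t ts gE] := @mvt_line g p v s s0.
  by move=> t /gd [].
have [|t' ts' E] := @mvt_line ('D_v f) (p + t *: v) w s s0.
  by move=> t' ts'; apply: (cdf v).2.1; apply: rU; exact: near_r.
exists (p + t *: v + t' *: w); first exact: near_r.
move: gE; have [_ ->] := gd t ts; rewrite E /g => gE.
transitivity (s * (s * 'D_w ('D_v f) (p + t *: v + t' *: w))); last by ring.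
rewrite -gE; ring.
Qed.

(** Were the two values different, the equal mixed derivatives at the nearby points [q1] and [q2]
    would each lie within half the gap of a different one of them. *)
Lemma derive_comm f U p v w : open U -> U p -> Ck 2 U f ->
  'D_w ('D_v f) p = 'D_v ('D_w f) p.
Proof.
move=> oU Up cf; apply/eqP/negPn/negP => ne.
have e0 : 0 < `|'D_w ('D_v f) p - 'D_v ('D_w f) p| / 2.
  by rewrite divr_gt0// normr_gt0 subr_eq0.
have /continuous_distP/(_ _ e0)[r1 r10 H1] := ((cf.2.2 v).2.2 w).1 p Up.
have /continuous_distP/(_ _ e0)[r2 r20 H2] := ((cf.2.2 w).2.2 v).1 p Up.
have [r3 r30 H3] := open_distP oU Up.
pose r := Num.min r1 (Num.min r2 r3).
have r0 : 0 < r by rewrite !lt_min r10 r20 r30.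
have rU q : `|q - p| < r -> U q by rewrite !lt_min => /and3P[_ _ /H3].
have K0 : 0 < `|v| + `|w| + 1 by rewrite ltr_wpDl// addr_ge0.
pose s := r / (`|v| + `|w| + 1).
have s0 : 0 < s by rewrite divr_gt0.
have sr : s * (`|v| + `|w|) < r.
  by rewrite /s mulrAC ltr_pdivrMr// ltr_pM2l// ltrDl.
have sr' : s * (`|w| + `|v|) < r by rewrite addrC.
have [q1 q1r E1] := second_difference oU cf rU (ltW s0) sr.
have [q2 q2r E2] := second_difference oU cf rU (ltW s0) sr'.
have E : 'D_w ('D_v f) q1 = 'D_v ('D_w f) q2.
  have s20 : s ^+ 2 != 0 by rewrite expf_neq0// gt_eqF.
  apply: (mulfI s20); apply: etrans (esym E1) (etrans _ E2).
  by rewrite (addrAC p) [X in X + _ = _]addrAC.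
have A1 : `|'D_w ('D_v f) q1 - 'D_w ('D_v f) p| <
    `|'D_w ('D_v f) p - 'D_v ('D_w f) p| / 2.
  by apply: H1; move: q1r; rewrite !lt_min => /and3P[].
have A2 : `|'D_v ('D_w f) q2 - 'D_v ('D_w f) p| <
    `|'D_w ('D_v f) p - 'D_v ('D_w f) p| / 2.
  by apply: H2; move: q2r; rewrite !lt_min => /and3P[].
move: A1 A2; rewrite -{}E.
move: ('D_w ('D_v f) q1) ('D_w ('D_v f) p) ('D_v ('D_w f) p) => C A B A1 A2.
have := le_lt_trans (ler_normB _ _) (ltrD A1 A2).
by rewrite -splitr opprB addrC addrA subrK distrC ltxx.
Qed.

End LineCalculus.

(** * Smooth functions *)

Section Smooth.
Context {R : realType} {V : normedModType R}.
Implicit Types (f g : V -> R) (p v w : V) (U : set V).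

Lemma open_near U f g p : open U -> U p -> (forall q, U q -> f q = g q) ->
  \forall q \near p, f q = g q.
Proof.
move=> oU Up fg; have := open_nbhs_nbhs (conj oU Up).
by apply: filterS => q /fg.
Qed.

Lemma derive_eq_on U f g p v : open U -> U p -> (forall q, U q -> f q = g q) ->
  'D_v f p = 'D_v g p.
Proof. by move=> oU Up fg; apply/near_eq_derive/(open_near oU Up). Qed.

Lemma Ck_eq k U f g : open U -> (forall q, U q -> f q = g q) ->
  Ck k U f -> Ck k U g.
Proof.
move=> oU; elim: k f g => [|k IH] f g fg [cf].
  move=> _; split=> // p Up.
  have E : \forall q \near p, f q = g q by exact: (open_near oU).
  rewrite /prop_for /continuous_at -fg//.
  by apply: cvg_trans (cf p Up); apply: near_eq_cvg.
move=> [df ddf]; split.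
  move=> p Up; have E : \forall q \near p, f q = g q by exact: (open_near oU).
  rewrite /prop_for /continuous_at -fg//.
  by apply: cvg_trans (cf p Up); apply: near_eq_cvg.
split.
  move=> p v Up; apply: near_eq_derivable (df p v Up).
  exact: (open_near oU).
move=> v; apply: IH (ddf v) => q Uq.
exact: (derive_eq_on v oU Uq).
Qed.

Lemma Ck_continuous k U f p : Ck k U f -> U p -> {for p, continuous f}.
Proof. by case: k => [|k] [cf _] Up; exact: cf. Qed.

Lemma Ck_S k U f : Ck k.+1 U f -> Ck k U f.
Proof.
elim: k f => [|k IH] f; first by case.
by move=> [cf [df ddf]]; split=> //; split=> // v; exact: IH.
Qed.

Definition smooth U f := forall k, Ck k U f.

Lemma smooth_derive U f v : smooth U f -> smooth U ('D_v f).
Proof. by move=> sf k; have [_ [_]] := sf k.+1; exact. Qed.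

Lemma smooth_derivable U f p v : smooth U f -> U p -> derivable f p v.
Proof. by move=> sf Up; have [_ [df _]] := sf 1%N; exact: df. Qed.

Lemma smooth_eq U f g : open U -> (forall q, U q -> f q = g q) ->
  smooth U f -> smooth U g.
Proof. by move=> oU fg sf k; exact: Ck_eq (sf k). Qed.

Lemma smooth_continuous U f p : smooth U f -> U p -> {for p, continuous f}.
Proof. by move=> sf; apply: (@Ck_continuous 0); exact: sf. Qed.

Lemma smooth_on_smooth U f : smooth_on U f -> smooth U f.
Proof.
move=> sf k; elim: k f sf => [|k IH] f sf.
  by split=> // p Up; have [] := sf [::] p Up.
split; first by move=> p Up; have [] := sf [::] p Up.
split; first by move=> p v Up; have [_] := sf [::] p Up; exact.
move=> v; apply: IH => vs p Up.
have E : iter_derive vs ('D_v f) = iter_derive (vs ++ [:: v]) f.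
  by elim: vs => //= u vs ->.
by rewrite E; exact: sf.
Qed.

Lemma Ck_cst k U (c : R) : Ck k U (fun=> c).
Proof.
elim: k c => [|k IH] c; first by split=> // p _; exact: cst_continuous.
split; first by move=> p _; exact: cst_continuous.
split; first by move=> p v _; exact: derivable_cst.
move=> v; rewrite (_ : 'D_v _ = fun=> 0) //; apply/funext => p.
exact: derive_cst.
Qed.

Lemma Ck_add k U f g : open U -> Ck k U f -> Ck k U g ->
  Ck k U (fun p => f p + g p).
Proof.
move=> oU; elim: k f g => [|k IH] f g [cf +] [cg +].
  move=> _ _; split=> // p Up.
  by apply: (@continuousD _ _ _ f g); [exact: cf|exact: cg].
move=> [df ddf] [dg ddg]; split.
  by move=> p Up; apply: (@continuousD _ _ _ f g); [exact: cf|exact: cg].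
split.
  by move=> p v Up; apply: (@derivableD _ _ _ f g); [exact: df|exact: dg].
move=> v; apply: (Ck_eq oU _ (IH _ _ (ddf v) (ddg v))) => p Up.
by rewrite -deriveD //; [exact: df|exact: dg].
Qed.

Lemma Ck_mul k U f g : open U -> Ck k U f -> Ck k U g ->
  Ck k U (fun p => f p * g p).
Proof.
move=> oU; elim: k f g => [|k IH] f g.
  move=> [cf _] [cg _]; split=> // p Up.
  by apply: (@continuousM _ _ f g); [exact: cf|exact: cg].
move=> Hf Hg; have [cf [df ddf]] := Hf; have [cg [dg ddg]] := Hg.
split.
  by move=> p Up; apply: (@continuousM _ _ f g); [exact: cf|exact: cg].
split.
  by move=> p v Up; apply: (@derivableM _ _ f g); [exact: df|exact: dg].
move=> v.
have := Ck_add oU (IH _ _ (Ck_S Hf) (ddg v)) (IH _ _ (Ck_S Hg) (ddf v)).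
apply: Ck_eq oU _ => p Up.
by rewrite -[LHS](@deriveM _ _ f g)//; [exact: df|exact: dg].
Qed.

(** The derivative of [1 / f] is [- (1 / f)^2] times that of [f], so order [k] for [1 / f] yields
    order [k + 1]. *)
Lemma Ck_inv k U f : open U -> (forall p, U p -> f p != 0) -> Ck k U f ->
  Ck k U (fun p => (f p)^-1).
Proof.
move=> oU f0; elim: k => [|k IH].
  by move=> [cf _]; split=> // p Up; apply: continuousV; [exact: f0|exact: cf].
move=> Hf; have [cf [df ddf]] := Hf.
split; first by move=> p Up; apply: continuousV; [exact: f0|exact: cf].
split.
  by move=> p v Up; apply: (@derivableV _ _ f); [exact: f0|exact: df].
move=> v; have Hi := IH (Ck_S Hf).
have H := Ck_mul oU (@Ck_cst k U (-1)) (Ck_mul oU (Ck_mul oU Hi Hi) (ddf v)).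
apply: (Ck_eq oU _ H) => p Up.
rewrite (@deriveV _ _ f); [|exact: f0|exact: df].
by rewrite mulN1r scaleNr -exprVn expr2.
Qed.

Lemma is_derive_lin (l : V -> R) p v :
  (forall p v h, l (h *: v + p) = h * l v + l p) -> is_derive p v l (l v).
Proof.
move=> ll.
suff H : h^-1 *: ((l \o shift p) (h *: v) - l p) @[h --> 0^'] --> l v.
  by split; [apply/cvg_ex; exists (l v)|apply/cvg_lim].
apply: cvg_near_cst; near=> h.
rewrite /= ll addrK /GRing.scale/= mulKf//.
by near: h; exact: nbhs_dnbhs_neq.
Unshelve. all: by end_near. Qed.

Lemma smooth_lin U (l : V -> R) : continuous l ->
  (forall p v h, l (h *: v + p) = h * l v + l p) -> smooth U l.
Proof.
move=> cl ll [|k]; first by split=> // p _; exact: cl.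
split; first by move=> p _; exact: cl.
split; first by move=> p v _; have [] := is_derive_lin p v ll.
move=> v; rewrite (_ : 'D_v l = fun=> l v); first exact: Ck_cst.
by apply/funext => p; have [] := is_derive_lin p v ll.
Qed.

Section Closure.
Variables (U : set V) (oU : open U).

Lemma smooth_cst (c : R) : smooth U (fun=> c).
Proof. by move=> k; exact: Ck_cst. Qed.

Lemma smooth_add f g : smooth U f -> smooth U g -> smooth U (fun p => f p + g p).
Proof. by move=> sf sg k; exact: Ck_add. Qed.

Lemma smooth_mul f g : smooth U f -> smooth U g -> smooth U (fun p => f p * g p).
Proof. by move=> sf sg k; exact: Ck_mul. Qed.

Lemma smooth_opp f : smooth U f -> smooth U (fun p => - f p).
Proof.
move=> sf; apply: smooth_eq (smooth_mul (smooth_cst (-1)) sf) => // p _.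
by rewrite mulN1r.
Qed.

Lemma smooth_sub f g : smooth U f -> smooth U g -> smooth U (fun p => f p - g p).
Proof. by move=> sf /smooth_opp; exact: smooth_add. Qed.

Lemma smooth_inv f : (forall p, U p -> f p != 0) -> smooth U f ->
  smooth U (fun p => (f p)^-1).
Proof. by move=> f0 sf k; exact: Ck_inv. Qed.

Lemma smooth_sum (I : Type) (r : seq I) (P : pred I) (F : I -> V -> R) :
  (forall i, smooth U (F i)) -> smooth U (fun p => \sum_(i <- r | P i) F i p).
Proof.
move=> sF; elim: r => [|i r IH].
  by apply: smooth_eq (smooth_cst 0) => // p _; rewrite big_nil.
case Pi : (P i).
  by apply: smooth_eq (smooth_add (sF i) IH) => // p _; rewrite big_cons Pi.
by apply: smooth_eq IH => // p _; rewrite big_cons Pi.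
Qed.

Lemma smooth_prod (I : Type) (r : seq I) (P : pred I) (F : I -> V -> R) :
  (forall i, smooth U (F i)) -> smooth U (fun p => \prod_(i <- r | P i) F i p).
Proof.
move=> sF; elim: r => [|i r IH].
  by apply: smooth_eq (smooth_cst 1) => // p _; rewrite big_nil.
case Pi : (P i).
  by apply: smooth_eq (smooth_mul (sF i) IH) => // p _; rewrite big_cons Pi.
by apply: smooth_eq IH => // p _; rewrite big_cons Pi.
Qed.

Lemma smooth_sqr f : smooth U f -> smooth U (fun p => f p ^+ 2).
Proof. by move=> sf; exact: smooth_mul. Qed.

Lemma smooth_det m (A : V -> 'M[R]_m) :
  (forall i j, smooth U (fun p => A p i j)) -> smooth U (fun p => \det (A p)).
Proof.
move=> sA; apply: smooth_sum => s; apply: smooth_mul; first exact: smooth_cst.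
by apply: smooth_prod => i; exact: sA.
Qed.

(** Cramer's rule: the entries are cofactors divided by the determinant. *)
Lemma smooth_invmx m (A : V -> 'M[R]_m) :
  (forall p, U p -> A p \in unitmx) ->
  (forall i j, smooth U (fun p => A p i j)) ->
  forall i j, smooth U (fun p => invmx (A p) i j).
Proof.
move=> uA sA i j.
have s1 : smooth U (fun p => (\det (A p))^-1).
  apply: smooth_inv; last exact: smooth_det.
  by move=> p /uA; rewrite unitmxE unitfE.
have s2 : smooth U (fun p => cofactor (A p) j i).
  apply: smooth_mul; first exact: smooth_cst.
  apply: smooth_det => k l.
  by apply: smooth_eq (sA (lift j k) (lift i l)) => // p _; rewrite !mxE.
by apply: smooth_eq (smooth_mul s1 s2) => // p Up; rewrite /invmx uA// !mxE.
Qed.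

End Closure.
End Smooth.

(** * Rules of calculus for smooth functions and the chain rule along curves *)

Section SmoothCalculus.
Context {R : realType} {V : normedModType R}.
Variables (U : set V) (oU : open U).
Implicit Types (f g : V -> R) (p v w : V).

Lemma derive_vsum (I : Type) (r : seq I) (a : I -> R) (e : I -> V) f p :
  smooth U f -> U p ->
  'D_(\sum_(i <- r) a i *: e i) f p = \sum_(i <- r) a i * 'D_(e i) f p.
Proof.
move=> sf Up; elim: r => [|i r IH]; first by rewrite !big_nil derive0.
rewrite !big_cons (deriveDv _ _ oU Up (sf 1%N)) IH deriveZv//.
exact: smooth_derivable sf Up.
Qed.

Lemma smooth_deriveDv f p v w : smooth U f -> U p ->
  'D_(v + w) f p = 'D_v f p + 'D_w f p.
Proof. by move=> sf Up; exact: deriveDv oU Up (sf 1%N). Qed.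

Lemma smooth_deriveZv f p v (a : R) : smooth U f -> U p ->
  'D_(a *: v) f p = a * 'D_v f p.
Proof. by move=> sf Up; exact: deriveZv (smooth_derivable sf Up). Qed.

Lemma smooth_comm f p v w : smooth U f -> U p ->
  'D_w ('D_v f) p = 'D_v ('D_w f) p.
Proof. by move=> sf Up; exact: derive_comm oU Up (sf 2%N). Qed.

Lemma smooth_deriveD f g p v : smooth U f -> smooth U g -> U p ->
  'D_v (fun q => f q + g q) p = 'D_v f p + 'D_v g p.
Proof.
by move=> sf sg Up; rewrite -deriveD//; exact: (smooth_derivable _ Up).
Qed.

Lemma smooth_deriveB f g p v : smooth U f -> smooth U g -> U p ->
  'D_v (fun q => f q - g q) p = 'D_v f p - 'D_v g p.
Proof.
by move=> sf sg Up; rewrite -deriveB//; exact: (smooth_derivable _ Up).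
Qed.

Lemma smooth_deriveM f g p v : smooth U f -> smooth U g -> U p ->
  'D_v (fun q => f q * g q) p = f p * 'D_v g p + g p * 'D_v f p.
Proof.
move=> sf sg Up; rewrite (@deriveM _ _ f g)//.
  exact: (smooth_derivable sf Up).
exact: (smooth_derivable sg Up).
Qed.

Lemma smooth_deriveZ f p v (a : R) : smooth U f -> U p ->
  'D_v (fun q => a * f q) p = a * 'D_v f p.
Proof.
move=> sf Up; rewrite (@smooth_deriveM (fun=> a) f)//; last exact: smooth_cst.
by rewrite derive_cst mulr0 addr0.
Qed.

Lemma smooth_derive_sqr f p v : smooth U f -> U p ->
  'D_v (fun q => f q ^+ 2) p = 2 * f p * 'D_v f p.
Proof.
move=> sf Up; rewrite (@smooth_deriveM f f)// -mulrDl -mulr2n.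
by rewrite -(mulr_natl (f p) 2).
Qed.

Lemma smooth_derive_sum (I : Type) (r : seq I) (F : I -> V -> R) p v :
  (forall i, smooth U (F i)) -> U p ->
  'D_v (fun q => \sum_(i <- r) F i q) p = \sum_(i <- r) 'D_v (F i) p.
Proof.
move=> sF Up; elim: r => [|i r IH].
  rewrite big_nil (_ : (fun q => _) = fun=> 0) ?derive_cst//.
  by apply/funext => q; rewrite big_nil.
rewrite big_cons -IH -smooth_deriveD//; last exact: smooth_sum.
by congr ('D_v _ p); apply/funext => q; rewrite big_cons.
Qed.

(** This encodes finite dimension for an abstract normed space: a finite generating family with
    coefficients bounded by the norm. Estimates uniform in the direction then reduce to finitely
    many derivatives. *)
Definition frame (I : finType) (e : I -> V) (c : V -> I -> R) :=
  forall u, u = \sum_i c u i *: e i /\ forall i, `|c u i| <= `|u|.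

Variables (I : finType) (e : I -> V) (c : V -> I -> R).
Hypothesis hfr : frame e c.

(** The finitely many frame derivatives are bounded near [p] by continuity. The ball is convex, so
    the mean value theorem applies on the segment from [b] to [a], and the derivative along [a - b]
    expands in the frame. *)
Lemma locally_lipschitz f p : smooth U f -> U p ->
  exists r C : R, [/\ 0 < r, 0 <= C, forall a, `|a - p| < r -> U a &
    forall a b, `|a - p| < r -> `|b - p| < r -> `|f a - f b| <= C * `|a - b|].
Proof.
move=> sf Up.
pose M i := `|'D_(e i) f p| + 1.
have H i : \forall q \near p, `|'D_(e i) f q| <= M i.
  have cd := smooth_continuous (smooth_derive (e i) sf) Up.
  have : \forall q \near p, `|'D_(e i) f q - 'D_(e i) f p| < 1.
    exact: cvgr_distC_lt cd _ ltr01.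
  apply: filterS => q.
  rewrite /M; move: ('D_(e i) f q) ('D_(e i) f p) => a b ab.
  rewrite -(subrK b a) (le_trans (ler_normD _ _))// addrC lerD2l.
  exact: ltW.
have /nbhs_normP[r1 r10 H1] : \forall q \near p, forall i, `|'D_(e i) f q| <= M i.
  exact: filter_forall.
have [r2 r20 H2] := open_distP oU Up.
exists (Num.min r1 r2), (\sum_i M i); split.
- by rewrite lt_min r10.
- by apply: sumr_ge0 => i _; rewrite addr_ge0.
- by move=> a; rewrite lt_min => /andP[_ /H2].
move=> a b ap bp.
have seg t : 0 <= t <= 1 -> `|b + t *: (a - b) - p| < Num.min r1 r2.
  move=> /andP[t0 t1].
  rewrite (_ : _ - p = (1 - t) *: (b - p) + t *: (a - p)); last first.
    have -> : a - p = (a - b) + (b - p) by rewrite addrA subrK.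
    by rewrite (scalerDr t (a - b)) [RHS]addrCA -scalerDl subrK scale1r [LHS]addrAC [LHS]addrC.
  rewrite (le_lt_trans (ler_normD _ _))// !normrZ.
  rewrite (ger0_norm t0) (@ger0_norm _ (1 - t)) ?subr_ge0//.
  set m := Num.min r1 r2; rewrite -/m in ap bp.
  have [->|t0'] := eqVneq t 0; first by rewrite subr0 mul1r mul0r addr0.
  rewrite [ltRHS](_ : m = (1 - t) * m + t * m); last by ring.
  rewrite ler_ltD//; first by rewrite ler_wpM2l ?subr_ge0// ltW.
  by rewrite ltr_pM2l// lt_def t0'.
have [t t01|t t01 E] := @mvt_line R V f b (a - b) 1 ler01.
  apply: (smooth_derivable sf); apply: H2.
  by have := seg t t01; rewrite lt_min => /andP[].
have Ut : U (b + t *: (a - b)).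
  by apply: H2; have := seg t t01; rewrite lt_min => /andP[].
have Et : b + 1 *: (a - b) = a by rewrite scale1r addrC subrK.
rewrite Et in E; rewrite E mul1r.
have [cE cle] := hfr (a - b).
have -> : 'D_(a - b) f (b + t *: (a - b)) =
    \sum_i c (a - b) i * 'D_(e i) f (b + t *: (a - b)).
  by rewrite -derive_vsum// -cE.
rewrite mulr_suml.
rewrite (le_trans (ler_norm_sum _ _ _))//; apply: ler_sum => i _.
rewrite normrM mulrC ler_pM//.
apply: H1; rewrite /= distrC.
by have := seg t t01; rewrite lt_min => /andP[].
Qed.

(** The curve deviates from the straight line [z t + h *: u] by [o(h)]; by the local Lipschitz bound
    the values of [f] on the two differ by [o(h)] as well, so the directional derivative is
    inherited. *)
Lemma is_derive_curve f (z : R -> V) (t : R) : smooth U f -> U (z t) ->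
  derivable z t 1 -> is_derive t 1 (fun s => f (z s)) ('D_('D_1 z t) f (z t)).
Proof.
move=> sf Uz dz; set u := 'D_1 z t.
have [r [C [r0 C0 rU rL]]] := locally_lipschitz sf Uz.
have df : h^-1 *: ((f \o shift (z t)) (h *: u) - f (z t)) @[h --> 0^'] -->
    'D_u f (z t) by exact: (smooth_derivable sf Uz).
have dz' : h^-1 *: ((z \o shift t) (h *: 1) - z t) @[h --> 0^'] --> u by exact: dz.
suff H : h^-1 *: (((fun s => f (z s)) \o shift t) (h *: 1) - f (z t)) @[h --> 0^']
    --> 'D_u f (z t).
  by split; [apply/cvg_ex; exists ('D_u f (z t))|apply/cvg_lim].
apply: cvg_sub0 df.
apply/norm_cvg0P.
have Cz : C * `|h^-1 *: ((z \o shift t) (h *: 1) - z t) - u| @[h --> 0^'] --> (0 : R).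
  rewrite -[X in _ --> X](mulr0 C); apply: cvgM; first exact: cvg_cst.
  apply/norm_cvg0P; apply/subr_cvg0; exact: dz'.
apply: squeeze_cvgr (cvg_cst 0) Cz.
have near1 : \forall h \near 0^', `|z (h *: 1 + t) - z t| < r.
  have cz : {for t, continuous z} by apply/differentiable_continuous/derivable1_diffP.
  have /nbhs_normP[d d0 Hd] : \forall q \near t, `|z q - z t| < r.
    exact: cvgr_distC_lt cz _ r0.
  near=> h; apply: Hd; rewrite /= opprD addrCA subrr addr0 normrN [h *: 1]mulr1.
  by near: h; exact: dnbhs0_lt.
have near2 : \forall h \near 0^', `|h *: u + z t - z t| < r.
  near=> h; rewrite addrK normrZ.
  have hd : `|h| < r / (`|u| + 1).
    by near: h; apply: dnbhs0_lt; rewrite divr_gt0// ltr_wpDl.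
  apply: (@le_lt_trans _ _ (r / (`|u| + 1) * `|u|)).
    by rewrite ler_wpM2r// ltW.
  by rewrite mulrAC ltr_pdivrMr ?ltr_wpDl// ltr_pM2l// ltrDl.
near=> h; rewrite normr_ge0/=.
have h0 : h != 0 by near: h; exact: nbhs_dnbhs_neq.
rewrite [X in `|X|](_ : _ = h^-1 * (f (z (h *: 1 + t)) - f (h *: u + z t))); last first.
  change (h^-1 * (f (z (h *: 1 + t)) - f (z t)) -
    h^-1 * (f (h *: u + z t) - f (z t)) =
    h^-1 * (f (z (h *: 1 + t)) - f (h *: u + z t))).
  by rewrite -mulrBr opprB addrA subrK.
rewrite normrM.
have lip : `|f (z (h *: 1 + t)) - f (h *: u + z t)| <=
    C * `|z (h *: 1 + t) - (h *: u + z t)|.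
  by apply: rL; near: h.
apply: (le_trans (ler_wpM2l (normr_ge0 _) lip)).
rewrite mulrCA ler_wpM2l// -normrZ scalerBr scalerDr scalerA mulVf// scale1r.
by rewrite [u + _]addrC opprD addrA scalerBr.
Unshelve. all: by end_near. Qed.

End SmoothCalculus.

(** * Coordinates on vectors and on pairs *)

Section ProductFrame.
Context {R : realType} {n : nat}.
Local Notation V := 'rV[R]_n.

Lemma norm_coord_le (v : V) i : `|v 0 i| <= `|v|.
Proof.
rewrite [leRHS]/Num.Def.normr/= mx_normrE.
exact: (@le_bigmax _ _ _ 0 (fun ij : 'I_1 * 'I_n => `|v ij.1 ij.2|) (0, i)).
Qed.

Lemma norm_coordP (v : V) (e : R) : 0 <= e -> (forall i, `|v 0 i| <= e) -> `|v| <= e.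
Proof.
move=> e0 H; rewrite [leLHS]/Num.Def.normr/= mx_normrE.
by apply: bigmax_le => // -[i j] _; rewrite (ord1 i).
Qed.

Lemma pair_norm_le (u : V * V) : `|u.1| <= `|u| /\ `|u.2| <= `|u|.
Proof. by rewrite prod_normE; split; rewrite le_max lexx ?orbT. Qed.

Lemma sum_pair0 (I : Type) (r : seq I) (a : I -> R) (e : I -> V) :
  (0 : V, \sum_(i <- r) a i *: e i) = \sum_(i <- r) a i *: (0 : V, e i) :> V * V.
Proof.
elim: r => [|i r IH]; first by rewrite !big_nil.
by rewrite !big_cons -IH; congr (_, _); rewrite /= scaler0 addr0.
Qed.

Lemma sum_pairl0 (I : Type) (r : seq I) (a : I -> R) (e : I -> V) :
  (\sum_(i <- r) a i *: e i, 0 : V) = \sum_(i <- r) a i *: (e i, 0 : V) :> V * V.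
Proof.
elim: r => [|i r IH]; first by rewrite !big_nil.
by rewrite !big_cons -IH; congr (_, _); rewrite /= scaler0 addr0.
Qed.

Definition tframe (i : 'I_n + 'I_n) : V * V :=
  match i with inl j => (ebase j, 0) | inr j => (0, ebase j) end.
Definition tcoef (u : V * V) (i : 'I_n + 'I_n) : R :=
  match i with inl j => u.1 0 j | inr j => u.2 0 j end.

Lemma pair_sumE (u : V * V) : u = \sum_i tcoef u i *: tframe i.
Proof.
rewrite big_sumType/= -sum_pair0 -sum_pairl0 -!row_sum_delta; case: u => a b.
by congr (_, _); rewrite /= ?addr0 ?add0r.
Qed.

Lemma tframeP : frame tframe tcoef.
Proof.
move=> u; split; first exact: pair_sumE.
have [h1 h2] := pair_norm_le u.
by case=> j; [apply: le_trans h1|apply: le_trans h2]; exact: norm_coord_le.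
Qed.

Lemma ebase_sum (v : V) : v = \sum_i v 0 i *: ebase i.
Proof. exact: row_sum_delta. Qed.

End ProductFrame.

(** * Local existence for ordinary differential equations *)

Section RealLemmas.
Context {R : realType}.

(** The mean value theorem for [g] minus a linear candidate of slope [c], in either order of [s] and
    [t]. With [c = B = 0] it yields constancy; with [c] the expected derivative it controls the
    remainder. *)
Lemma bounded_derivative_estimate (g dg : R -> R) (c B : R) (s t : R) :
  (forall r, `|r - s| <= `|t - s| -> Num.min s t <= r <= Num.max s t ->
     is_derive r 1 g (dg r) /\ `|dg r - c| <= B) ->
  `|g t - g s - c * (t - s)| <= B * `|t - s|.
Proof.
move=> H.
have key (a b : R) : a <= b -> (forall r, a <= r <= b ->
     is_derive r 1 g (dg r) /\ `|dg r - c| <= B) ->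
   `|g b - g a - c * (b - a)| <= B * `|b - a|.
  move=> ab Hab.
  have [r|r|r] := @MVT_segment R g dg a b ab.
  - by rewrite in_itv/= => /andP[ar rb]; apply: (Hab r _).1; rewrite !ltW.
  - apply: (@derivable_within_continuous _ _ _ `[a, b]) r => r.
    by rewrite in_itv/= => /Hab[[]].
  - rewrite in_itv/= => abr ->; rewrite -mulrBl normrM.
    by rewrite ler_wpM2r// (Hab r abr).2.
have [st|ts] := leP s t.
  apply: key => // r /andP[sr rt]; apply: H.
    by rewrite !ger0_norm ?subr_ge0// lerD2r.
  by rewrite (min_idPl st) (max_idPr st) sr.
rewrite (_ : g t - g s - c * (t - s) = - (g s - g t - c * (s - t))); last by ring.
rewrite normrN (distrC t); apply: key; first exact: ltW.
move=> r /andP[tr rs]; apply: H.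
  by rewrite ler0_norm ?subr_le0// ltr0_norm ?subr_lt0// lerN2 lerD2r.
by rewrite (min_idPr (ltW ts)) (max_idPl (ltW ts)) tr.
Qed.

Lemma le_geometric_error (a b d : R) : (forall k : nat, a <= b + d / 2 ^+ k) -> a <= b.
Proof.
move=> H; apply/ler_addgt0Pr => e e0.
have : (fun k => d / 2 ^+ k) @ \oo --> (0 : R).
  rewrite -[X in _ --> X](mulr0 d); apply: cvgM; first exact: cvg_cst.
  have h2 : `|2^-1 : R| < 1 by rewrite ger0_norm ?invr_ge0// invf_lt1// ltr1n.
  have := cvg_expr h2; apply: cvg_trans; apply: near_eq_cvg.
  by near=> k; rewrite exprVn.
move=> /cvgrPdist_lt/(_ _ e0)[N _ HN].
have := HN N (leqnn N); rewrite sub0r normrN => dN.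
by apply: (le_trans (H N)); rewrite lerD2l ltW// (le_lt_trans (ler_norm _)).
Unshelve. all: by end_near. Qed.

(** The intervals [[x k - e k, x k + e k]] are nested, and the supremum of their left ends lies in
    all of them. *)
Lemma geometric_limit (x : nat -> R) (C : R) : 0 <= C ->
  (forall k, `|x k.+1 - x k| <= C / 2 ^+ k) ->
  exists l, forall k, `|x k - l| <= 2 * C / 2 ^+ k.
Proof.
move=> C0 H.
(* The tail of the series of the [C / 2 ^+ j] from [j = k] on, whence
   [e k = e k.+1 + C / 2 ^+ k]. *)
pose e k := 2 * C / 2 ^+ k.
have e0 k : 0 <= e k by rewrite divr_ge0 ?mulr_ge0// exprn_ge0.
have eS k : e k = e k.+1 + C / 2 ^+ k.
  rewrite /e exprS; have : (2 : R) ^+ k != 0 by rewrite expf_neq0.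
  by move: (2 ^+ k) => y y0; field.
have am k m : (k <= m)%N -> x k - e k <= x m - e m.
  move=> /subnK <-; elim: (m - k)%N => // j IH; apply: (le_trans IH).
  rewrite addSn; have := H (j + k)%N; have := eS (j + k)%N.
  by rewrite ler_norml => -> /andP[h _]; lra.
have bm k m : (k <= m)%N -> x m + e m <= x k + e k.
  move=> /subnK <-; elim: (m - k)%N => // j IH; apply: le_trans IH.
  rewrite addSn; have := H (j + k)%N; have := eS (j + k)%N.
  by rewrite ler_norml => -> /andP[_ h]; lra.
have ab k m : x k - e k <= x m + e m.
  have [km|mk] := leqP k m.
    by apply: (le_trans (am _ _ km)); rewrite lerD2l ge0_cp// ?e0.
  apply: le_trans (bm _ _ (ltnW mk)); rewrite lerD2l ge0_cp// ?e0.
pose S := range (fun k => x k - e k).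
have S0 : S !=set0 by exists (x 0%N - e 0%N); exists 0%N.
exists (sup S) => k; rewrite ler_distlC; apply/andP; split.
  apply: ub_le_sup; last by exists k.
  by exists (x 0%N + e 0%N) => _ [m _ <-].
by apply: ge_sup => // _ [m _ <-].
Qed.

(** The integral from [- u] is precomposed with the truncation [cl] to [[- d, d]], which makes it
    continuous on the whole line without changing it where [|t| < d]. The margin [u = d + 1] keeps
    truncated points in the interior, where the fundamental theorem applies. *)
Lemma continuous_primitive (f : R -> R) (d : R) : 0 < d -> continuous f ->
  exists g : R -> R, [/\ g 0 = 0, continuous g &
    forall t : R, `|t| < d -> is_derive t 1 g (f t)].
Proof.
move=> d0 cf; pose u := d + 1.
have du : d < u by rewrite ltrDl.
have fint : (lebesgue_measure).-integrable [set` `[- u, u]] (EFin \o f).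
  apply: continuous_compact_integrable; first exact: segment_compact.
  exact: continuous_subspaceT.
pose G x := (\int[lebesgue_measure]_(t in [set` `[- u, x]]) f t)%R.
have dG x : - u < x < u -> is_derive x 1 G (f x).
  move=> /andP[ux xu].
  have [dG GE] := continuous_FTC1_closed xu fint ux (cf x).
  exact: DeriveDef dG (etrans (esym (derive1E _ _)) GE).
pose cl t := Num.max (- d) (Num.min d t).
have clE t : `|t| < d -> cl t = t.
  rewrite ltr_norml /cl => /andP[dt td].
  by rewrite (min_idPr (ltW td)) (max_idPr (ltW dt)).
have clu t : - u < cl t < u.
  rewrite /cl lt_max gt_max gt_min du orTb andbT ltrN2 du orTb/=.
  by rewrite (lt_trans _ (lt_trans d0 du))// oppr_lt0.
have ccl : continuous cl.
  move=> t; apply: (@continuous_max _ _ (fun=> - d) (fun t => Num.min d t)).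
    exact: cst_continuous.
  apply: (@continuous_min _ _ (fun=> d) id); first exact: cst_continuous.
  exact: id.
exists (fun t => G (cl t) - G 0); split.
- by rewrite clE ?normr0// subrr.
- move=> t; apply: (@continuousB _ _ _ (G \o cl) (fun=> G 0)); last exact: cst_continuous.
  apply: continuous_comp; first exact: ccl.
  by apply/differentiable_continuous/derivable1_diffP; have [] := dG _ (clu t).
move=> t td.
have near_t : \forall s \near t, G s - G 0 = G (cl s) - G 0.
  apply/nbhs_normP; exists (d - `|t|); first by rewrite /= subr_gt0.
  move=> s /=; rewrite ltrBrDr => st; rewrite clE//.
  by apply: le_lt_trans st; rewrite -{1}(subrK t s) distrC ler_normD.
apply: near_eq_is_derive near_t _.
rewrite -[f t]subr0; apply: is_deriveB.
by apply: dG; rewrite -ltr_norml (lt_trans td).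
Qed.

End RealLemmas.

(** * Picard iteration in finite dimension *)

Section Picard.
Context {R : realType} {m : nat}.
Local Notation V := 'rV[R]_m.

Lemma rV_continuous (f : R -> V) : (forall j, continuous (fun t => f t 0 j)) ->
  continuous f.
Proof.
move=> cf t; apply/cvgrPdist_le => e e0.
have Hj j : \forall s \near t, `|f t 0 j - f s 0 j| <= e.
  exact: cvgr_dist_le (cf j t) _ e0.
near=> s; apply: norm_coordP => [|j]; first exact: ltW.
rewrite !mxE; move: j; near: s; exact: filter_forall.
Unshelve. all: by end_near. Qed.

Lemma is_derive_rV (f : R -> V) (t : R) (v : V) :
  (forall j, is_derive t 1 (fun s => f s 0 j) (v 0 j)) -> is_derive t 1 f v.
Proof.
move=> H; have df : derivable f t 1.
  by apply/derivable_mxP => i j; rewrite (ord1 i); have [] := H j.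
split=> //; rewrite derive_mx//; apply/rowP => j; rewrite mxE.
by have [_] := H j.
Qed.

Lemma is_derive_coord (f : R -> V) (t : R) (v : V) j :
  is_derive t 1 f v -> is_derive t 1 (fun s => f s 0 j) (v 0 j).
Proof.
move=> [df <-]; split; first by move/derivable_mxP : df; exact.
by rewrite derive_mx// mxE.
Qed.

(** A quadratic remainder bound passes to pointwise limits, unlike derivability; in this form the
    limit of the Picard iterates is shown to solve its equation. *)
Lemma quadratic_is_derive (f : R -> R) (s a C r : R) : 0 < r ->
  (forall t, `|t - s| < r -> `|f t - f s - a * (t - s)| <= C * `|t - s| ^+ 2) ->
  is_derive s 1 f a.
Proof.
move=> r0 H.
suff L : h^-1 *: ((f \o shift s) (h *: 1) - f s) @[h --> 0^'] --> a.
  by split; [apply/cvg_ex; exists a|apply/cvg_lim].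
apply/subr_cvg0/norm_cvg0P.
have Ch : C * `|h| @[h --> (0 : R)^'] --> 0.
  rewrite -[X in _ --> X](mulr0 C); apply: cvgM; first exact: cvg_cst.
  by apply/norm_cvg0P/nbhs_dnbhs; exact: cvg_id.
apply: squeeze_cvgr (cvg_cst 0) Ch; near=> h.
rewrite normr_ge0/=.
have h0 : h != 0 by near: h; exact: nbhs_dnbhs_neq.
have hs : h + s - s = h by rewrite addrK.
have hr : `|h + s - s| < r by rewrite hs; near: h; exact: dnbhs0_lt.
have := H _ hr; rewrite hs => L.
have -> : h^-1 *: ((f \o shift s) (h *: 1) - f s) - a =
    h^-1 * (f (h + s) - f s - a * h).
  rewrite /= [h *: 1]mulr1 [RHS]mulrBr.
  by rewrite [X in _ = _ - X]mulrCA mulVf// mulr1.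
rewrite normrM normfV ler_pdivrMl ?normr_gt0//.
by rewrite mulrCA -expr2.
Unshelve. all: by end_near. Qed.

Lemma rV_coordB (a b : V) j : (a - b) 0 j = a 0 j - b 0 j.
Proof. by rewrite !mxE. Qed.

Lemma picard_global (Y : V -> V) (K M : R) (z0 : V) :
  (forall a b, `|Y a - Y b| <= K * `|a - b|) -> (forall a, `|Y a| <= M) ->
  exists2 d : R, 0 < d & exists2 z : R -> V, z 0 = z0 &
    forall t : R, `|t| < d -> is_derive t 1 z (Y (z t)).
Proof.
wlog K1 : K / 1 <= K.
  move=> W YK YM; have [K1|/ltW K1] := leP 1 K; first exact: (W K).
  apply: (W 1) => // a b; apply: le_trans (YK a b) _.
  by rewrite ler_wpM2r.
move=> YK YM.
have M0 : 0 <= M by apply: le_trans (YM 0).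
have K0 : 0 < K by apply: lt_le_trans K1.
(* On this length one integration of [Y] contracts by the factor [K * d = 1 / 2]. *)
pose d := (2 * K)^-1; have d0 : 0 < d by rewrite invr_gt0 mulr_gt0.
have Kd : K * d = 2^-1 by rewrite /d invfM mulrCA mulfV ?mulr1// gt_eqF.
(* A primitive is chosen for every function at once, with an arbitrary value off the continuous
   ones, so that the Picard operator [T] is total and can be iterated. *)
have [prim primP] : {prim : (R -> R) -> R -> R & forall f, continuous f ->
    [/\ prim f 0 = 0, continuous (prim f) &
    forall t : R, `|t| < d -> is_derive t 1 (prim f) (f t)]}.
  apply: (@choice _ _ (fun f g => continuous f -> [/\ g 0 = 0, continuous g &
    forall t : R, `|t| < d -> is_derive t 1 g (f t)])) => f.
  have [cf|ncf] := pselect (continuous f); last by exists f.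
  by have [g gP] := continuous_primitive d0 cf; exists g.
pose T (z : R -> V) (t : R) : V :=
  z0 + \row_j prim (fun s => Y (z s) 0 j) t.
pose u k := iter k T (fun=> z0).
have cY (z : R -> V) j : continuous z -> continuous (fun s => Y (z s) 0 j).
  move=> cz t; apply/cvgrPdist_lt => e e0.
  have eK : 0 < e / K by rewrite divr_gt0.
  have Hz : \forall s \near t, `|z t - z s| < e / K.
    exact: cvgr_dist_lt (cz t) _ eK.
  near=> s; have zs : K * `|z t - z s| < e.
    by rewrite mulrC -ltr_pdivlMr//; near: s; exact: Hz.
  apply: le_lt_trans zs; apply: le_trans (YK _ _).
  by apply: le_trans (norm_coord_le _ j); rewrite rV_coordB.
have Tc z j t : T z t 0 j = z0 0 j + prim (fun s => Y (z s) 0 j) t.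
  by rewrite !mxE.
have cu k : continuous (u k).
  elim: k => [|k IH]; first by move=> t; exact: cst_continuous.
  apply: rV_continuous => j.
  rewrite (_ : (fun t => _) = fun t => z0 0 j + prim (fun s => Y (u k s) 0 j) t).
    move=> t; apply: (@continuousD _ _ _ (fun=> z0 0 j)).
      exact: cst_continuous.
    by have [_ c _] := primP _ (cY _ j IH); exact: c.
  by apply/funext => t; rewrite /u iterS Tc.
have du k (t : R) j : `|t| < d -> is_derive t 1 (fun t => u k.+1 t 0 j) (Y (u k t) 0 j).
  move=> td; rewrite (_ : (fun t => _) =
     fun t => z0 0 j + prim (fun s => Y (u k s) 0 j) t).
    have [_ _ /(_ t td) D] := primP _ (cY _ j (cu k)).
    by rewrite -[Y _ 0 j]add0r; apply: is_deriveD.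
  by apply/funext => s; rewrite /u iterS Tc.
have u0 k : u k 0 = z0.
  case: k => // k; apply/rowP => j; rewrite /u iterS Tc.
  by have [-> _ _] := primP _ (cY _ j (cu k)); rewrite addr0.
have between (s t r : R) : `|s| < d -> `|t| < d ->
    Num.min s t <= r <= Num.max s t -> `|r| < d.
  rewrite !ltr_norml ge_min le_max => /andP[s1 s2] /andP[t1 t2] /andP[r1 r2].
  apply/andP; split.
    by case/orP: r1; apply: lt_le_trans.
  by case/orP: r2 => h; apply: le_lt_trans h _.
have lipu k s t : `|s| < d -> `|t| < d -> `|u k t - u k s| <= M * `|t - s|.
  move=> sd td; case: k => [|k].
    by rewrite subrr normr0 mulr_ge0.
  apply: norm_coordP => [|j]; first by rewrite mulr_ge0.
  have := @bounded_derivative_estimate _ (fun t => u k.+1 t 0 j)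
    (fun t => Y (u k t) 0 j) 0 M s t.
  rewrite rV_coordB mul0r subr0; apply => r _ rst.
  split; first by apply: du; exact: between rst.
  by rewrite subr0 (le_trans (norm_coord_le _ j)).
have d00 : `|(0 : R)| < d by rewrite normr0.
have step k t : `|t| < d -> `|u k.+1 t - u k t| <= M * d / 2 ^+ k.
  elim: k t => [|k IH] t td.
    rewrite expr0 divr1; have -> : u 0%N t = u 1%N 0 by rewrite u0.
    apply: (le_trans (lipu 1%N _ _ d00 td)).
    by rewrite subr0 ler_wpM2l// ltW.
  apply: norm_coordP => [|j].
    by rewrite divr_ge0 ?mulr_ge0 ?exprn_ge0// ltW.
  pose g r := u k.+2 r 0 j - u k.+1 r 0 j.
  pose dg r := Y (u k.+1 r) 0 j - Y (u k r) 0 j.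
  have := @bounded_derivative_estimate _ g dg 0 (K * (M * d / 2 ^+ k)) 0 t.
  have g0 : g 0 = 0 by rewrite /g !u0 subrr.
  rewrite mul0r g0 !subr0 => H; rewrite rV_coordB.
  apply: (le_trans (H _)) => [r _ rst|].
    have rd := between _ _ _ d00 td rst.
    split; first by apply: is_deriveB; exact: du.
    rewrite subr0; apply: le_trans (_ : `|Y (u k.+1 r) - Y (u k r)| <= _).
      by apply: le_trans (norm_coord_le _ j); rewrite rV_coordB.
    by apply: (le_trans (YK _ _)); rewrite ler_pM2l// IH.
  have A0 : 0 <= M * d / 2 ^+ k by rewrite divr_ge0 ?mulr_ge0 ?exprn_ge0// ltW.
  apply: (@le_trans _ _ (K * (M * d / 2 ^+ k) * d)).
    by rewrite ler_wpM2l ?mulr_ge0 ?(ltW K0)// ltW.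
  rewrite mulrAC Kd exprS invfM mulrCA (mulrC (2^-1)) mulrA.
  by rewrite mulrC.
have [z zP] : {z : R -> V & forall t, `|t| < d -> forall k,
    `|u k t - z t| <= 2 * (M * d) / 2 ^+ k}.
  apply: (@choice _ _ (fun t zt => `|t| < d -> forall k,
    `|u k t - zt| <= 2 * (M * d) / 2 ^+ k)) => t.
  have [td|ntd] := pselect (`|t| < d); last by exists 0.
  have Md : 0 <= M * d by rewrite mulr_ge0// ltW.
  have lim j : {l | forall k, `|u k t 0 j - l| <= 2 * (M * d) / 2 ^+ k}.
    apply/cid/geometric_limit => // k.
    apply: le_trans (step k t td).
    by apply: le_trans (norm_coord_le _ j); rewrite rV_coordB.
  exists (\row_j sval (lim j)) => _ k; apply: norm_coordP => [|j].
    by rewrite divr_ge0 ?mulr_ge0 ?exprn_ge0// ltW.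
  by rewrite rV_coordB mxE; exact: (svalP (lim j) k).
have z00 : z 0 = z0.
  apply/eqP; rewrite -subr_eq0 -normr_le0.
  apply: (@le_geometric_error _ _ _ (2 * (M * d))) => k.
  by rewrite add0r distrC -(u0 k); exact: zP.
have lipz s t : `|s| < d -> `|t| < d -> `|z t - z s| <= M * `|t - s|.
  move=> sd td.
  apply: (@le_geometric_error _ _ _ (2 * (M * d) + 2 * (M * d))) => k.
  rewrite (_ : z t - z s = (z t - u k t) + ((u k t - u k s) + (u k s - z s))).
    apply: (le_trans (ler_normD _ _)).
    rewrite distrC; have e1 := zP t td k; have e2 := lipu k s t sd td.
    have e3 := zP s sd k; have e4 := ler_normD (u k t - u k s) (u k s - z s).
    apply: (le_trans (lerD e1 (le_trans e4 (lerD e2 e3)))).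
    by rewrite addrCA -mulrDl.
  by rewrite addrA subrKA subrKA.
exists d => //; exists z => // s sd.
apply: is_derive_rV => j.
apply: (@quadratic_is_derive _ _ _ (K * M) (d - `|s|)); first by rewrite subr_gt0.
move=> t ts.
have td : `|t| < d.
  rewrite -(subrK s t) (le_lt_trans (ler_normD _ _))//.
  by move: ts; rewrite ltrBrDr.
set D := M * d; set q := `|t - s|.
(* Errors of order [2 ^- k]: replacing [z] by [u k.+1] at [t] and at [s] costs [2 * D] each, and the
   velocity [Y (u k r)] in place of [Y (z r)] costs the third term. Only [K * M * q ^+ 2] survives
   the limit. *)
apply: (@le_geometric_error _ _ _ (2 * D + 2 * D + K * (2 * D) * q)) => k.
have E1 : `|u k.+1 t 0 j - u k.+1 s 0 j - Y (z s) 0 j * (t - s)| <=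
   (K * (2 * D / 2 ^+ k + M * q)) * q.
  apply: (@bounded_derivative_estimate _ (fun t => u k.+1 t 0 j)
    (fun t => Y (u k t) 0 j)) => r rq rst.
  have rd := between _ _ _ sd td rst.
  split; first exact: du.
  apply: le_trans (_ : `|Y (u k r) - Y (z s)| <= _).
    by apply: le_trans (norm_coord_le _ j); rewrite rV_coordB.
  apply: (le_trans (YK _ _)); rewrite ler_pM2l//.
  rewrite -(subrKA (z r)) (le_trans (ler_normD _ _))// lerD ?zP//.
  by apply: (le_trans (lipz _ _ sd rd)); rewrite ler_wpM2l.
have E2 t' : `|t'| < d -> `|u k.+1 t' 0 j - z t' 0 j| <= 2 * D / 2 ^+ k.
  move=> td'; apply: le_trans (_ : 2 * D / 2 ^+ k.+1 <= _).
    by apply: le_trans (zP _ td' k.+1); apply: le_trans (norm_coord_le _ j); rewrite rV_coordB.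
  have D0 : 0 <= 2 * D by rewrite !mulr_ge0// ltW.
  rewrite ler_wpM2l// lef_pV2 ?posrE ?exprn_gt0//.
  by rewrite exprS ler_peMl// ?exprn_ge0// ler1n.
have E2t := E2 t td; have E2s := E2 s sd.
rewrite (_ : z t 0 j - _ - _ = (u k.+1 t 0 j - u k.+1 s 0 j - Y (z s) 0 j * (t - s))
  + (- (u k.+1 t 0 j - z t 0 j) + (u k.+1 s 0 j - z s 0 j))); last first.
  by move: (u k.+1 t 0 j) (u k.+1 s 0 j) (z t 0 j) (z s 0 j) (Y (z s) 0 j) => *; ring.
apply: (le_trans (ler_normD _ _)).
apply: (le_trans (lerD E1 (ler_normD _ _))).
rewrite normrN; apply: (le_trans (lerD (lexx _) (lerD E2t E2s))).
move: (2 ^+ k)^-1 => w; rewrite le_eqVlt; apply/orP; left; apply/eqP; ring.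
Unshelve. all: by end_near. Qed.

End Picard.

(** * Second-order equations by truncation to a cube *)

Section SecondOrder.
Context {R : realType} {n : nat}.
Local Notation V := 'rV[R]_n.

Definition clamp (e x : R) : R := Num.max (- e) (Num.min e x).

Lemma clamp_mono e x y : x <= y -> clamp e x <= clamp e y.
Proof.
move=> xy; rewrite /clamp; case: (leP e x) => h1; case: (leP e y) => h2;
  case: (leP (- e) e) => h3; case: (leP (- e) x) => h4;
  case: (leP (- e) y) => h5; lra.
Qed.

Lemma clamp_increment e x y : x <= y -> clamp e y - clamp e x <= y - x.
Proof.
move=> xy; rewrite /clamp; case: (leP e x) => h1; case: (leP e y) => h2;
  case: (leP (- e) e) => h3; case: (leP (- e) x) => h4;
  case: (leP (- e) y) => h5; lra.
Qed.

Lemma clamp_lipschitz e x y : `|clamp e x - clamp e y| <= `|x - y|.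
Proof.
wlog xy : x y / x <= y.
  move=> W; have [/W//|/ltW/W] := leP x y.
  by rewrite distrC (distrC y).
rewrite distrC (distrC x) !ger0_norm ?subr_ge0//; first exact: clamp_increment.
exact: clamp_mono.
Qed.

Lemma clamp_bound e x : 0 <= e -> `|clamp e x| <= e.
Proof.
move=> e0; rewrite ler_norml /clamp le_max lexx/= ge_max ge_min lexx/= andbT.
lra.
Qed.

Lemma clamp_id e x : `|x| <= e -> clamp e x = x.
Proof.
by rewrite ler_norml /clamp => /andP[h1 h2]; rewrite (min_idPr h2) (max_idPr h1).
Qed.

Definition vclamp (e : R) (p v : V) : V := p + \row_j clamp e (v 0 j - p 0 j).

Lemma vclamp_lipschitz e p v w : `|vclamp e p v - vclamp e p w| <= `|v - w|.
Proof.
apply: norm_coordP => // j; rewrite !mxE.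
rewrite (_ : p 0 j + _ - _ = clamp e (v 0 j - p 0 j) - clamp e (w 0 j - p 0 j)); last first.
  by rewrite opprD addrACA subrr add0r.
apply: (le_trans (clamp_lipschitz _ _ _)).
rewrite (_ : _ - _ = (v - w) 0 j); first exact: norm_coord_le.
by rewrite !mxE opprB addrA subrK.
Qed.

Lemma vclamp_bound e p v : 0 <= e -> `|vclamp e p v - p| <= e.
Proof.
by move=> e0; apply: norm_coordP => // j; rewrite !mxE addrC addKr clamp_bound.
Qed.

Lemma vclamp_id e p v : `|v - p| <= e -> vclamp e p v = v.
Proof.
move=> vp; apply/rowP => j; rewrite !mxE clamp_id; first by rewrite addrC subrK.
by apply: le_trans vp; apply: le_trans (norm_coord_le _ j); rewrite !mxE.
Qed.

Lemma lsubmx_norm_le (w : 'rV[R]_(n + n)) : `|lsubmx w| <= `|w|.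
Proof. by apply: norm_coordP => // j; rewrite mxE norm_coord_le. Qed.

Lemma rsubmx_norm_le (w : 'rV[R]_(n + n)) : `|rsubmx w| <= `|w|.
Proof. by apply: norm_coordP => // j; rewrite mxE norm_coord_le. Qed.

Lemma row_mx_norm_le (a b : V) e : `|a| <= e -> `|b| <= e -> `|row_mx a b| <= e.
Proof.
move=> ae be; apply: norm_coordP => [|j]; first exact: le_trans ae.
by rewrite mxE; case: (fintype.split j) => k; exact: le_trans (norm_coord_le _ k) _.
Qed.

(* Precomposing with the 1-Lipschitz clamp onto a cube around [p0] makes the
   locally Lipschitz field globally Lipschitz and bounded. *)
Lemma second_order_picard (G : V * V -> V) (p0 : V * V) (r K : R) : 0 < r -> 0 <= K ->
  (forall a b, `|a - p0| < r -> `|b - p0| < r -> `|G a - G b| <= K * `|a - b|) ->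
  exists2 d : R, 0 < d & exists c v : R -> V,
    [/\ c 0 = p0.1, v 0 = p0.2 & forall t : R, `|t| < d ->
      [/\ is_derive t 1 c (v t), is_derive t 1 v (G (c t, v t)) &
          `|(c t, v t) - p0| < r]].
Proof.
move=> r0 K0 GL; pose e := r / 2.
have e0 : 0 < e by rewrite divr_gt0.
have er : e < r by rewrite /e ltr_pdivrMr// mulr2n mulrDr mulr1 ltrDr.
pose cl (w : 'rV[R]_(n + n)) : V * V :=
  (vclamp e p0.1 (lsubmx w), vclamp e p0.2 (rsubmx w)).
have normP (u : V * V) x : `|u.1| <= x -> `|u.2| <= x -> `|u| <= x.
  by move=> u1 u2; rewrite prod_normE ge_max u1.
have clb w : `|cl w - p0| <= e by apply: normP; apply/vclamp_bound/ltW.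
have clr w : `|cl w - p0| < r by apply: le_lt_trans er.
have cll w w' : `|cl w - cl w'| <= `|w - w'|.
  apply: normP.
    apply: (le_trans (vclamp_lipschitz _ _ _ _)).
    by rewrite -linearB; exact: lsubmx_norm_le.
  apply: (le_trans (vclamp_lipschitz _ _ _ _)).
  by rewrite -linearB; exact: rsubmx_norm_le.
(* The first-order system [c' = v], [v' = G (c, v)], evaluated at truncated points. *)
pose Y w := row_mx (cl w).2 (G (cl w)).
have YL w w' : `|Y w - Y w'| <= (K + 1) * `|w - w'|.
  have -> : Y w - Y w' = row_mx ((cl w).2 - (cl w').2) (G (cl w) - G (cl w')).
    by rewrite /Y opp_row_mx add_row_mx.
  apply: row_mx_norm_le.
    apply: (le_trans (pair_norm_le (cl w - cl w')).2).
    by apply: (le_trans (cll _ _)); rewrite ler_peMl// lerDr.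
  apply: (le_trans (GL _ _ (clr _) (clr _))).
  apply: (@le_trans _ _ (K * `|w - w'|)); first by rewrite ler_wpM2l.
  by rewrite ler_wpM2r// lerDl.
pose M := (`|p0| + r) + (`|G p0| + K * r).
have p0r : `|p0 - p0| < r by rewrite subrr normr0.
have YM w : `|Y w| <= M.
  apply: row_mx_norm_le.
    apply: (le_trans (pair_norm_le (cl w)).2).
    rewrite -(subrK p0 (cl w)) (le_trans (ler_normD _ _))// addrC.
    rewrite /M -addrA lerD2l (le_trans (ltW (clr w)))// lerDl.
    by rewrite addr_ge0// mulr_ge0// ltW.
  rewrite -(subrK (G p0) (G (cl w))) (le_trans (ler_normD _ _))// addrC.
  rewrite /M (@le_trans _ _ (`|G p0| + K * r))// ?lerDr ?addr_ge0 ?(ltW r0)//.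
  rewrite lerD2l (le_trans (GL _ _ (clr _) p0r))// ler_wpM2l//.
  exact: ltW (clr w).
have [d d0 [z z0 dz]] := picard_global (row_mx p0.1 p0.2) YL YM.
(* By continuity the solution stays for a short time in the cube where [cl] is the identity, and
   there it solves the original system. *)
have z_cont : {for 0, continuous z}.
  apply/differentiable_continuous/derivable1_diffP.
  by have [] := dz 0 _; rewrite ?normr0.
have /nbhs_normP[d' d'0 Hd'] : \forall t \near 0, `|z t - z 0| < e.
  exact: cvgr_distC_lt z_cont _ e0.
exists (Num.min d d'); first by rewrite lt_min d0.
exists (fun t => lsubmx (z t)), (fun t => rsubmx (z t)); split.
- by rewrite z0 row_mxKl.
- by rewrite z0 row_mxKr.
move=> t; rewrite lt_min => /andP[td td'].
have zt : `|z t - row_mx p0.1 p0.2| < e.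
  by rewrite -z0; apply: Hd'; rewrite /= sub0r normrN.
have zl : `|lsubmx (z t) - p0.1| <= e.
  rewrite -(row_mxKl p0.1 p0.2) -linearB; apply: le_trans (ltW zt).
  exact: lsubmx_norm_le.
have zr : `|rsubmx (z t) - p0.2| <= e.
  rewrite -(row_mxKr p0.1 p0.2) -linearB; apply: le_trans (ltW zt).
  exact: rsubmx_norm_le.
have clz : cl (z t) = (lsubmx (z t), rsubmx (z t)) by rewrite /cl !vclamp_id.
have D := dz t td; rewrite /Y clz in D.
split; last by apply: le_lt_trans er; exact: normP.
- apply: is_derive_rV => j; have := is_derive_coord (lshift n j) D.
  rewrite row_mxEl/=; congr (is_derive _ _ _ _).
  by apply/funext => s; rewrite mxE.
- apply: is_derive_rV => j; have := is_derive_coord (rshift n j) D.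
  rewrite row_mxEr/=; congr (is_derive _ _ _ _).
  by apply/funext => s; rewrite mxE.
Qed.

End SecondOrder.

(** * Calculus on the slit tangent bundle *)

Section SlitCalculus.
Context {R : realType} {n : nat}.
Local Notation V := 'rV[R]_n.
Variables (Omega : set V) (oO : open Omega).
Local Notation U := (slit Omega).
Implicit Types (f g : V * V -> R) (p : V * V) (v w x y : V).

Lemma snd_coord_continuous k : continuous (fun p : V * V => p.2 0 k).
Proof.
move=> p; apply: (@continuous_comp _ _ _ snd (fun v : V => v 0 k)).
  exact: cvg_snd.
exact: coord_continuous.
Qed.

Lemma open_slit : open U.
Proof.
have -> : U = (fst @^-1` Omega) `&` (snd @^-1` [set y : V | y != 0]).
  by apply/seteqP; split.
apply: openI.
  by apply: open_comp => // p _; exact: cvg_fst.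
apply: open_comp; first by move=> p _; exact: cvg_snd.
rewrite openE => y y0; suff : \forall z \near y, z != 0 by [].
apply/nbhs_normP; exists `|y|; first by rewrite /= normr_gt0.
by move=> z /=; apply: contraTneq => ->; rewrite subr0 ltxx.
Qed.

Lemma smooth_snd_coord k : smooth U (fun p => p.2 0 k).
Proof.
by apply: smooth_lin => [|p v h]; [exact: snd_coord_continuous|rewrite !mxE].
Qed.

Lemma derive_snd_coord p (u : V * V) k : 'D_u (fun p => p.2 0 k) p = u.2 0 k.
Proof.
have l (q v : V * V) (h : R) : (h *: v + q).2 0 k = h * v.2 0 k + q.2 0 k.
  by rewrite !mxE.
by have [] := @is_derive_lin R (V * V)%type (fun p => p.2 0 k) p u l.
Qed.

Lemma pair0Z (a : R) w : (0 : V, a *: w) = a *: (0 : V, w).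
Proof. by apply: injective_projections; rewrite /= ?scaler0. Qed.

Lemma derive_dxE f p w : smooth U f -> U p ->
  'D_(w, 0) f p = \sum_k w 0 k * 'D_(ebase k, 0) f p.
Proof.
move=> sf Up; rewrite {1}(ebase_sum w) sum_pairl0.
by apply: (derive_vsum open_slit).
Qed.

Lemma derive_dyE f p w : smooth U f -> U p ->
  'D_(0, w) f p = \sum_k w 0 k * 'D_(0, ebase k) f p.
Proof.
move=> sf Up; rewrite {1}(ebase_sum w) sum_pair0.
by apply: (derive_vsum open_slit).
Qed.

(* [f_{x^k} y^k] in the paper's notation. *)
Definition hderive f : V * V -> R := fun p => \sum_k p.2 0 k * 'D_(ebase k, 0) f p.

Lemma hderiveE f p : smooth U f -> U p -> hderive f p = 'D_(p.2, 0) f p.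
Proof. by move=> sf Up; rewrite derive_dxE. Qed.

Lemma smooth_hderive f : smooth U f -> smooth U (hderive f).
Proof.
move=> sf; apply: (smooth_sum open_slit) => k.
apply: (smooth_mul open_slit); first exact: smooth_snd_coord.
exact: smooth_derive.
Qed.

(** The commutator of the fibre derivative along [w] with [y^k d/dx^k] is the base derivative along
    [w], because differentiating the coefficient [y^k] leaves [w^k]. *)
Lemma derive_hderive f p w : smooth U f -> U p ->
  'D_(0, w) (hderive f) p = 'D_(w, 0) f p + hderive ('D_(0, w) f) p.
Proof.
move=> sf Up; rewrite (smooth_derive_sum open_slit)//; last first.
  move=> k; apply: (smooth_mul open_slit); first exact: smooth_snd_coord.
  exact: smooth_derive.
rewrite derive_dxE// /hderive -big_split/=; apply: eq_bigr => k _.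
have E := smooth_deriveM (0, w) (smooth_snd_coord k)
  (smooth_derive (ebase k, 0) sf) Up.
apply: (etrans E); rewrite [LHS]addrC.
have E1 := derive_snd_coord p (0, w) k.
have E2 := smooth_comm open_slit (ebase k, 0) (0, w) sf Up.
apply: (congr2 +%R (etrans (congr1 _ E1) (mulrC _ _)) (congr1 _ E2)).
Qed.

Definition fibre_homogeneous (k : nat) f := forall (a : R) x y,
  0 < a -> U (x, y) -> f (x, a *: y) = a ^+ k * f (x, y).

Lemma slit_scale (a : R) x y : 0 < a -> U (x, y) -> U (x, a *: y).
Proof.
by move=> a0 [/= Ox y0]; split => //=; rewrite scaler_eq0 negb_or gt_eqF.
Qed.

(** The derivative at [t = 0] of [f] along [(x, (1 + t) y)] is computed twice: as a directional
    derivative, and from the explicit factor [(1 + t)^k], valid near [0] where [1 + t] is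
    positive. *)
Lemma euler k f p : fibre_homogeneous k f -> smooth U f -> U p ->
  'D_(0, p.2) f p = k%:R * f p.
Proof.
case: p => x y /= hf sf Up.
have d1 : is_derive (0 : R) 1 (fun t => f ((x, y) + t *: (0, y))) ('D_(0, y) f (x, y)).
  have := @is_derive_line _ _ f (x, y) (0, y) 0; rewrite scale0r addr0; apply.
  exact: smooth_derivable sf Up.
have d2 : is_derive (0 : R) 1 (fun t : R => (1 + t) ^+ k * f (x, y)) (k%:R * f (x, y)).
  have di : is_derive (0 : R) 1 (fun t : R => 1 + t) 1.
    by rewrite -[1 in X in is_derive _ _ _ X]add0r; apply: is_deriveD.
  have dX := @is_deriveX R R (fun t : R => 1 + t) k 0 1 1 di.
  have dM := @is_deriveM R R _ (fun=> f (x, y)) 0 1 _ 0 dX (is_derive_cst _ _ _).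
  have Ef : (fun t : R => (1 + t) ^+ k * f (x, y)) =
      (fun t : R => 1 + t) ^+ k * (fun=> f (x, y)).
    by apply/funext => t; rewrite !fctE.
  rewrite Ef; apply: is_derive_eq dM _.
  rewrite fctE /GRing.scale/= addr0 expr1n mulr0 add0r !mulr1 mulrC.
  by rewrite expr1n mulr1.
have E : \forall t \near (0 : R), f ((x, y) + t *: (0, y)) = (1 + t) ^+ k * f (x, y).
  apply/nbhs_normP; exists 1 => [|t /=]; first exact: ltr01.
  rewrite sub0r normrN ltr_norml => /andP[t1 _].
  rewrite (_ : _ + _ = (x, (1 + t) *: y)); first by apply: hf => //; lra.
  by congr (_, _); rewrite /= ?scaler0 ?addr0// scalerDl scale1r.
have [_ <-] := d1; have [_ <-] := d2.
exact: near_eq_derive.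
Qed.

Lemma derive_fibre_scale f (a : R) x y (u v : V) :
  'D_(u, v) (fun p => f (p.1, a *: p.2)) (x, y) = 'D_(u, a *: v) f (x, a *: y).
Proof.
have E : (fun h : R => h^-1 *: (((fun p => f (p.1, a *: p.2)) \o shift (x, y)) (h *: (u, v))
     - f (x, a *: y))) =
   (fun h : R => h^-1 *: ((f \o shift (x, a *: y)) (h *: (u, a *: v)) - f (x, a *: y))).
  apply/funext => h; congr (_ *: (f _ - _)).
  apply: injective_projections => //=.
  by rewrite scalerDr !scalerA mulrC.
by rewrite /derive E.
Qed.

Lemma fibre_homogeneous_dx k f w : fibre_homogeneous k f -> smooth U f ->
  fibre_homogeneous k ('D_(w, 0) f).
Proof.
move=> hf sf a x y a0 Up; have := @derive_fibre_scale f a x y w 0.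
rewrite scaler0 => <-.
rewrite -(smooth_deriveZ (w, 0) (a ^+ k) sf Up).
by apply: derive_eq_on open_slit Up _ => -[x' y'] Uq; exact: hf.
Qed.

Lemma fibre_homogeneous_dy k f w : fibre_homogeneous k.+1 f -> smooth U f ->
  fibre_homogeneous k ('D_(0, w) f).
Proof.
move=> hf sf a x y a0 Up; have an0 : a != 0 by rewrite gt_eqF.
apply: (mulfI an0); rewrite mulrA -exprS.
rewrite -(smooth_deriveZv _ _ sf (slit_scale a0 Up)) -pair0Z.
rewrite -derive_fibre_scale// -(smooth_deriveZ (0, w) (a ^+ k.+1) sf Up).
by apply: derive_eq_on open_slit Up _ => -[x' y'] Uq; exact: hf.
Qed.

Lemma fibre_homogeneous_hderive k f : fibre_homogeneous k f -> smooth U f ->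
  fibre_homogeneous k.+1 (hderive f).
Proof.
move=> hf sf a x y a0 Up; rewrite /hderive mulr_sumr; apply: eq_bigr => i _.
rewrite (fibre_homogeneous_dx _ hf sf)//= mxE exprS.
by move: (y 0 i) => b; rewrite -!mulrA; congr (_ * _); rewrite mulrCA.
Qed.

End SlitCalculus.

(** * Finsler metrics and their sprays *)

Section PosDef.
Context {R : realType} {n : nat}.
Local Notation V := 'rV[R]_n.
Implicit Types (A : 'M[R]_n) (v w : V).

Lemma bilinE A v w : bilin A v w = \sum_j w 0 j * \sum_i v 0 i * A i j.
Proof.
rewrite /bilin mxE; apply: eq_bigr => j _; rewrite !mxE mulrC; congr (_ * _).
Qed.

Lemma posdef_unitmx A : posdef A -> A \in unitmx.
Proof.
move=> pA; rewrite unitmxE unitfE; apply/negP => /det0P[v v0 vA].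
by have := pA v v0; rewrite /bilin vA mul0mx mxE ltxx.
Qed.

Lemma bilinDl A u v w : bilin A (u + v) w = bilin A u w + bilin A v w.
Proof. by rewrite /bilin mulmxDl mulmxDl mxE. Qed.

Lemma bilinZl A (a : R) v w : bilin A (a *: v) w = a * bilin A v w.
Proof. by rewrite /bilin -!scalemxAl mxE. Qed.

Lemma bilinZ A (a : R) v w : bilin (a *: A) v w = a * bilin A v w.
Proof. by rewrite /bilin -scalemxAr -scalemxAl mxE. Qed.

End PosDef.

(** * The fundamental tensor and the spray *)

Section FinslerMetric.
Context {R : realType} {n : nat}.
Local Notation V := 'rV[R]_n.
Variables (Omega : set V) (oO : open Omega) (F : V * V -> R).
Hypothesis hF : finsler_metric Omega F.
Local Notation U := (slit Omega).
Local Notation L := (sqF F).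
Implicit Types (p : V * V) (v w x y : V).

Let oU : open U := open_slit oO.

Lemma smooth_F : smooth U F.
Proof. by apply: smooth_on_smooth; have [] := hF. Qed.

Lemma smooth_L : smooth U L.
Proof. exact: smooth_sqr oU _ smooth_F. Qed.

Lemma F_gt0 p : U p -> 0 < F p.
Proof.
case: p => x y [/= Ox y0]; have [_ /(_ x Ox)[_ F0 Fz _ _]] := hF.
rewrite lt_def F0 andbT; apply/eqP => /Fz yz.
by rewrite yz eqxx in y0.
Qed.

Lemma homogeneous_F : fibre_homogeneous Omega 1 F.
Proof.
move=> a x y a0 [/= Ox _]; have [_ /(_ x Ox)[hom _ _ _ _]] := hF.
by rewrite expr1; exact: hom.
Qed.

Lemma homogeneous_L : fibre_homogeneous Omega 2 L.
Proof.
by move=> a x y a0 Up; rewrite /sqF homogeneous_F// expr1 exprMn.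
Qed.

Lemma hessian_gmx x y : hessian (fun z => F (x, z) ^+ 2) y = 2 *: gmx F (x, y).
Proof.
have E f w z : 'D_w (fun z => f (x, z)) z = 'D_(0, w) f (x, z).
  have E1 : (fun h : R => h^-1 *: (((fun z => f (x, z)) \o shift z) (h *: w) - f (x, z))) =
    (fun h : R => h^-1 *: ((f \o shift (x, z)) (h *: (0, w)) - f (x, z))).
    apply/funext => h; congr (_ *: (f _ - _)).
    by apply: injective_projections => //=; rewrite scaler0 add0r.
  by rewrite /derive E1.
have two0 : (2 : R) != 0 by rewrite pnatr_eq0.
apply/matrixP => i j; rewrite !mxE (mulVKf two0).
have E1 : 'D_(ebase i) (fun z => F (x, z) ^+ 2) = fun z => dy i L (x, z).
  by apply/funext => z; exact: E L _ _.
by rewrite E1; exact: E.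
Qed.

Lemma posdef_gmx p : U p -> posdef (gmx F p).
Proof.
case: p => x y [/= Ox y0] v v0; have [_ /(_ x Ox)[_ _ _ _ /(_ y y0 v v0)]] := hF.
by rewrite hessian_gmx bilinZ pmulr_rgt0.
Qed.

Lemma bilin_gmx p v w : U p ->
  bilin (gmx F p) v w = 2^-1 * 'D_(0, w) ('D_(0, v) L) p.
Proof.
move=> Up; rewrite bilinE.
have S i := smooth_derive (0, ebase i) smooth_L.
have E1 : 'D_(0, w) ('D_(0, v) L) p =
    'D_(0, w) (fun q => \sum_i v 0 i * dy i L q) p.
  by apply: (derive_eq_on _ oU Up) => q Uq; exact: (derive_dyE oO v smooth_L Uq).
have E2 : 'D_(0, w) (fun q => \sum_i v 0 i * dy i L q) p =
    \sum_i 'D_(0, w) (fun q => v 0 i * dy i L q) p.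
  apply: (smooth_derive_sum oU) => // i.
  exact: smooth_mul oU _ _ (smooth_cst _ _) (S i).
rewrite E1 E2; under [in RHS]eq_bigr => i _.
  rewrite (smooth_deriveZ (0, w) (v 0 i) (S i) Up).
  rewrite (derive_dyE oO w (S i) Up).
  over.
rewrite mulr_sumr; under [LHS]eq_bigr do rewrite mulr_sumr.
rewrite exchange_big/=; apply: eq_bigr => i _.
rewrite mulr_sumr mulr_sumr; apply: eq_bigr => j _.
rewrite /gmx mxE /dy; move: (w 0 j) (v 0 i) => a b.
by move: ('D_(_, _) _ p) => d; rewrite mulrCA (mulrCA a) (mulrCA b).
Qed.

Lemma bilin_gmxC p v w : U p -> bilin (gmx F p) v w = bilin (gmx F p) w v.
Proof.
move=> Up; rewrite (bilin_gmx v w Up) (bilin_gmx w v Up).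
exact: congr1 _ (smooth_comm oU (0, v) (0, w) smooth_L Up).
Qed.

(** The first fibre derivatives of [L] are homogeneous of degree one, so Euler's relation turns a
    second derivative along [y] back into a first derivative. *)
Lemma bilin_gmx_y p w : U p -> bilin (gmx F p) p.2 w = 2^-1 * 'D_(0, w) L p.
Proof.
move=> Up; rewrite (bilin_gmxC _ _ Up) (bilin_gmx _ _ Up).
have H := fibre_homogeneous_dy oO w homogeneous_L smooth_L.
have E := euler H (smooth_derive (0, w) smooth_L) Up.
exact: (congr1 (fun z => 2^-1 * z) (etrans E (mul1r _))).
Qed.

Lemma bilin_gmx_yy p : U p -> bilin (gmx F p) p.2 p.2 = L p.
Proof.
move=> Up; rewrite (bilin_gmx_y _ Up) (euler homogeneous_L smooth_L Up).
by rewrite mulrA mulVf ?mul1r// pnatr_eq0.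
Qed.

(** Contraction with [g] cancels the inverse matrix inside the spray coefficients, which leaves an
    expression free of [invmx]. *)
Lemma bilin_spray p w : U p ->
  bilin (gmx F p) w (spray F p) = 4^-1 * (hderive ('D_(0, w) L) p - 'D_(w, 0) L p).
Proof.
move=> Up; pose N j := \sum_k dy j (dx k L) p * p.2 0 k - dx j L p.
have Es : (spray F p)^T = 4^-1 *: (invmx (gmx F p) *m (\col_j N j)).
  apply/matrixP => i j; rewrite !mxE /spray_coef; congr (_ * _).
  by apply: eq_bigr => k _; rewrite [in RHS]mxE.
rewrite /bilin Es -scalemxAr -mulmxA (mulmxA _ (invmx _)).
rewrite mulmxV ?mul1mx; last exact/posdef_unitmx/posdef_gmx.
rewrite mxE mxE; congr (_ * _).
have S k := smooth_derive (ebase k, 0) smooth_L.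
rewrite (derive_dxE oO w smooth_L Up).
have -> : hderive ('D_(0, w) L) p =
    \sum_j w 0 j * \sum_k dy j (dx k L) p * p.2 0 k.
  under [RHS]eq_bigr do rewrite mulr_sumr.
  rewrite exchange_big/= /hderive; apply: eq_bigr => k _.
  have -> : 'D_(ebase k, 0) ('D_(0, w) L) p = 'D_(0, w) ('D_(ebase k, 0) L) p.
    exact: (smooth_comm oU (0, w) (ebase k, 0) smooth_L Up).
  rewrite (derive_dyE oO w (S k) Up) mulr_sumr; apply: eq_bigr => j _.
  by rewrite mulrCA [X in _ = _ * X]mulrC.
rewrite -sumrB; apply: eq_bigr => j _; rewrite mxE.
by rewrite -mulrBr.
Qed.

(** Infinitesimal conservation of energy: along [c'' = - 2 G] the derivative of [L] is
    [y^k L_{x^k} - 2 G^k L_{y^k}], which this identity makes zero. It is [bilin_spray] at [w = y]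
    combined with Euler's relation. *)
Lemma derive_spray p : U p -> 'D_(0, spray F p) L p = 2^-1 * hderive L p.
Proof.
move=> Up; have := bilin_gmx_y (spray F p) Up; rewrite (bilin_spray _ Up).
have E1 : 'D_(p.2, 0) L p = hderive L p by rewrite (hderiveE oO smooth_L Up).
have E2 : hderive ('D_(0, p.2) L) p = 2 * hderive L p.
  rewrite (hderiveE oO (smooth_derive _ smooth_L) Up).
  apply: (etrans (smooth_comm oU (0, p.2) (p.2, 0) smooth_L Up)).
  have H := fibre_homogeneous_dx oO p.2 homogeneous_L smooth_L.
  by apply: (etrans (euler H (smooth_derive _ smooth_L) Up)); rewrite E1.
rewrite E1 E2; move: (hderive L p) ('D_(0, _) L p) => a b E; lra.
Qed.

Lemma smooth_spray_coef i : smooth U (spray_coef F i).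
Proof.
have SL (v w : V * V) := smooth_derive v (smooth_derive w smooth_L).
apply: (smooth_mul oU); first exact: smooth_cst.
apply: (smooth_sum oU) => j; apply: (smooth_mul oU).
  apply: (smooth_invmx oU) => [p Up|k l].
    exact/posdef_unitmx/posdef_gmx.
  apply: (smooth_eq oU) (smooth_mul oU (smooth_cst _ 2^-1) (SL (0, ebase l) (0, ebase k))).
  by move=> p Up; rewrite mxE.
apply: (smooth_sub oU); last exact: (smooth_derive (ebase j, 0) smooth_L).
apply: (smooth_sum oU) => k; apply: (smooth_mul oU); first exact: SL.
exact: smooth_snd_coord.
Qed.

End FinslerMetric.

(** * Geodesics of a projectively flat metric *)

Section Curves.
Context {R : realType} {n : nat}.
Local Notation V := 'rV[R]_n.

Lemma is_derive_pair {W1 W2 : normedModType R} (c : R -> W1) (v : R -> W2) (t : R) a b :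
  is_derive t 1 c a -> is_derive t 1 v b ->
  is_derive t 1 (fun s => (c s, v s)) (a, b).
Proof.
move=> [dc <-] [dv <-].
suff H : h^-1 *: (((fun s => (c s, v s)) \o shift t) (h *: 1) - (c t, v t)) @[h --> 0^']
    --> ('D_1 c t, 'D_1 v t).
  by split; [apply/cvg_ex; exists ('D_1 c t, 'D_1 v t)|apply/cvg_lim].
exact: (cvg_pair dc dv).
Qed.

(** The line is parametrised by the [j]-th coordinate of the curve itself, so the parameter is
    differentiable whenever the curve is. *)
Lemma derive1_on_line (I : set R) (c : R -> V) (a y : V) (b k : R) j t :
  open I -> I t -> derivable c t 1 ->
  (forall s, I s -> c s = a + ((c s 0 j - b) * k) *: y) ->
  derive1 c t = ((derive1 c t) 0 j * k) *: y.
Proof.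
move=> oI It dc H; apply/rowP => i; rewrite mxE.
have D l : is_derive t 1 (fun s => c s 0 l) ((derive1 c t) 0 l).
  by apply: is_derive_coord; rewrite derive1E; exact: derivableP.
have D2 : is_derive t 1 (fun s => a 0 i + (c s 0 j - b) * (k * y 0 i))
    (derive1 c t 0 j * (k * y 0 i)).
  have D3 : is_derive t 1 (fun s => c s 0 j - b) (derive1 c t 0 j).
    by rewrite -[X in is_derive _ _ _ X]subr0; apply: is_deriveB.
  have D4 := @is_deriveM R R _ (fun=> k * y 0 i) t 1 _ 0 D3 (is_derive_cst _ _ _).
  have D5 := @is_deriveD R R R (fun=> a 0 i) _ t 1 0 _ (is_derive_cst _ _ _) D4.
  apply: is_derive_eq D5 _.
  by rewrite scaler0 !add0r /GRing.scale/= mulrC.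
have E : \forall s \near t, c s 0 i = a 0 i + (c s 0 j - b) * (k * y 0 i).
  have := open_nbhs_nbhs (conj oI It); apply: filterS => s Is.
  by rewrite {1}(H s Is) !mxE mulrA.
have [_ <-] := D i; rewrite (near_eq_derive _ E); have [_ ->] := D2.
by rewrite mulrA.
Qed.

(** Projective flatness supplies a parameter [r] for each time, with no regularity in [t]. A
    coordinate in which [v] does not vanish replaces it, and the nonzero velocity at [t0] then
    replaces [v]. *)
Lemma straight_curve (I : set R) (c : R -> V) (t0 : R) :
  open I -> I t0 -> derivable c t0 1 -> derive1 c t0 != 0 ->
  (exists a v : V, v != 0 /\ forall t, I t -> exists r : R, c t = a + r *: v) ->
  exists2 j, derive1 c t0 0 j != 0 & forall t, I t ->
    c t = c t0 + ((c t 0 j - c t0 0 j) * (derive1 c t0 0 j)^-1) *: derive1 c t0.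
Proof.
move=> oI It0 dc y0 [a [v [v0 H]]].
have [j vj] : exists j, v 0 j != 0 by exact/rV0Pn.
have H1 t : I t -> c t = c t0 + ((c t 0 j - c t0 0 j) * (v 0 j)^-1) *: v.
  move=> It; have [r Er] := H t It; have [r0 Er0] := H t0 It0.
  have -> : c t 0 j - c t0 0 j = (r - r0) * v 0 j by rewrite Er Er0 !mxE; ring.
  by rewrite mulfK// Er Er0 -addrA -scalerDl [r0 + _]addrC subrK.
have Ey := derive1_on_line oI It0 dc H1.
set y := derive1 c t0 in y0 Ey *.
have yj : y 0 j != 0.
  by apply: contra_neq y0 => yj; rewrite Ey yj mul0r scale0r.
exists j => // t It; rewrite {1}(H1 t It) [X in _ = _ + _ *: X]Ey scalerA.
congr (_ + _ *: _); move: (c t 0 j - c t0 0 j) (y 0 j) yj => u w w0.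
by rewrite mulrA -(mulrA u) mulVf// mulr1.
Qed.

End Curves.

(** * Local geodesics and the spray of a projectively flat metric *)

Section Geodesics.
Context {R : realType} {n : nat}.
Local Notation V := 'rV[R]_n.
Variables (Omega : set V) (oO : open Omega) (F : V * V -> R).
Hypothesis hF : finsler_metric Omega F.
Local Notation U := (slit Omega).
Local Notation L := (sqF F).
Implicit Types (p : V * V) (v w x y : V).

Let oU : open U := open_slit oO.

Lemma spray_locally_lipschitz p0 : U p0 -> exists r K : R,
  [/\ 0 < r, 0 <= K, forall a, `|a - p0| < r -> U a &
   forall a b, `|a - p0| < r -> `|b - p0| < r ->
     `|(-2) *: spray F a - (-2) *: spray F b| <= K * `|a - b|].
Proof.
move=> Up.
have H i : {rC : R * R | [/\ 0 < rC.1, 0 <= rC.2 &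
    forall a b, `|a - p0| < rC.1 -> `|b - p0| < rC.1 ->
    `|spray_coef F i a - spray_coef F i b| <= rC.2 * `|a - b|]}.
  apply/cid; have [r [C [r0 C0 _ rL]]] :=
    locally_lipschitz oU tframeP (smooth_spray_coef oO hF i) Up.
  by exists (r, C).
have [r0 r00 Hr0] := open_distP oU Up.
pose rr i := (sval (H i)).1; pose CC i := (sval (H i)).2.
have rr0 i : 0 < rr i by have [] := svalP (H i).
have CC0 i : 0 <= CC i by have [] := svalP (H i).
(* The inverse of a sum of inverses is a positive lower bound of [r0] and of all the [rr i]. *)
pose r := (r0^-1 + \sum_i (rr i)^-1)^-1.
have S0 : 0 <= \sum_i (rr i)^-1 by apply: sumr_ge0 => i _; rewrite invr_ge0 ltW.
have r_gt0 : 0 < r by rewrite invr_gt0 ltr_pwDl// invr_gt0.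
have r_r0 : r <= r0.
  by rewrite -[leRHS]invrK lef_pV2 ?posrE ?invr_gt0 ?lerDl// ltr_pwDl// invr_gt0.
have r_rr i : r <= rr i.
  rewrite -[leRHS]invrK lef_pV2 ?posrE ?invr_gt0//; last first.
    by rewrite ltr_pwDl// invr_gt0.
  rewrite (bigD1 i)//= addrCA lerDl addr_ge0 ?invr_ge0 ?(ltW r00)//.
  by apply: sumr_ge0 => k _; rewrite invr_ge0 ltW.
exists r, (2 * \sum_i CC i); split => //.
- by rewrite mulr_ge0// sumr_ge0.
- by move=> a ar; apply: Hr0; exact: lt_le_trans ar r_r0.
move=> a b ar br; rewrite -scalerBr normrZ normrN normr_nat -mulrA ler_pM2l//.
apply: norm_coordP => [|i]; first by rewrite mulr_ge0// sumr_ge0.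
rewrite rV_coordB /spray !mxE.
have [_ _ /(_ a b (lt_le_trans ar (r_rr i)) (lt_le_trans br (r_rr i)))] := svalP (H i).
move=> h; apply: (le_trans h); rewrite ler_wpM2r// -/(CC i).
by rewrite (bigD1 i)//= lerDl sumr_ge0.
Qed.

(** Picard's theorem gives the curve. The constant speed demanded by [geodesic] is a separate point:
    [L] is conserved by [derive_spray], and [F] is its positive square root. *)
Lemma geodesic_through x y : U (x, y) -> exists2 d : R, 0 < d &
  exists c : R -> V, [/\ geodesic Omega F [set t | `|t| < d] c, c 0 = x &
    derive1 c 0 = y].
Proof.
move=> Uxy; have [r [K [r0 K0 rU rL]]] := spray_locally_lipschitz Uxy.
have [d d0 [c [v [c0 v0 cv]]]] := second_order_picard r0 K0 rL.
have d1c (t : R) : `|t| < d -> derive1 c t = v t.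
  by move=> /cv[[_ +] _ _]; rewrite derive1E.
pose I := [set t : R | `|t| < d].
have oI : open I.
  rewrite (_ : I = `]- d, d[%classic); first exact: interval_open.
  by apply/seteqP; split => t; rewrite /I /= in_itv/= ltr_norml.
have d1c_near (t : R) : `|t| < d -> \forall s \near t, v s = derive1 c s.
  move=> td; have := open_nbhs_nbhs (conj oI td); apply: filterS => s sd.
  by rewrite d1c.
have dd1c (t : R) : `|t| < d -> is_derive t 1 (derive1 c) ((-2) *: spray F (c t, v t)).
  move=> td; have [_ dv _] := cv t td.
  exact: near_eq_is_derive (d1c_near t td) dv.
have Ut (t : R) : `|t| < d -> U (c t, v t) by move=> /cv[_ _ /rU].
have dL (t : R) : `|t| < d -> is_derive t 1 (fun s => L (c s, v s)) 0.
  move=> td; have [dc dv _] := cv t td.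
  have [dz zE] := is_derive_pair dc dv.
  have := is_derive_curve oU tframeP (smooth_L oO hF) (Ut t td) dz.
  rewrite zE => D; apply: is_derive_eq D _.
  have SL := smooth_L oO hF.
  have -> : (v t, (-2) *: spray F (c t, v t)) =
     (v t, 0) + (-2) *: (0, spray F (c t, v t)) :> V * V.
    by apply: injective_projections; rewrite /= ?scaler0 ?addr0 ?add0r.
  have E1 := smooth_deriveDv oU (v t, 0) ((-2) *: (0, spray F (c t, v t))) SL (Ut t td).
  have E2 := smooth_deriveZv (0, spray F (c t, v t)) (-2) SL (Ut t td).
  have E3 := derive_spray oO hF (Ut t td).
  have E4 := hderiveE oO SL (Ut t td).
  apply: (etrans E1); apply: (etrans (congr1 (fun z => _ + z) E2)).
  apply: (etrans (congr1 (fun z => _ + (-2) * z) E3)).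
  apply: (etrans (congr1 (fun z => z + _) (esym E4))).
  have cancel (z : R) : z + (-2) * (2^-1 * z) = 0.
    by rewrite mulNr mulVKf ?pnatr_eq0// subrr.
  exact: cancel.
have Lc (t : R) : `|t| < d -> L (c t, v t) = L (x, y).
  move=> td; have z0 : `|(0 : R)| < d by rewrite normr0.
  have := @bounded_derivative_estimate R (fun s => L (c s, v s)) (fun=> 0) 0 0 0 t.
  rewrite c0 v0 !(mul0r, subr0) => H; apply/eqP; rewrite -subr_eq0 -normr_le0.
  apply: H => s st _; rewrite ?subrr normr0; split => //.
  by apply: dL; apply: le_lt_trans td; move: st; rewrite !subr0.
have Fc (t : R) : `|t| < d -> F (c t, v t) = F (x, y).
  move=> td; have := Lc t td; rewrite /sqF => /eqP.
  by rewrite eqrXn2 ?ltW ?(F_gt0 hF)//; [move/eqP|exact: Ut].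
exists d => //; exists c; split => //; last by rewrite d1c ?normr0.
split.
- split; [by exists 0; rewrite /= normr0|exact: oI|].
  move=> s t /=; rewrite !ltr_norml => /andP[s1 s2] /andP[t1 t2] u /andP[u1 u2].
  by rewrite /= ltr_norml (lt_le_trans s1 u1) (le_lt_trans u2 t2).
- by move=> t /Ut[].
- move=> t /= td; have [[dc _] _ _] := cv t td.
  by have [D _] := dd1c t td; split; [exact: dc|exact: D].
- exists (F (x, y)); first exact: F_gt0 hF _ Uxy.
  by move=> t td; rewrite d1c// Fc.
- move=> t td; have [_ E] := dd1c t td; rewrite derive1E E d1c//.
  by rewrite -scalerDl addNr scale0r.
Qed.

Hypothesis pflat : projectively_flat Omega F.

Lemma hderive_L p : U p -> hderive L p = 2 * F p * hderive F p.
Proof.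
move=> Up; rewrite (hderiveE oO (smooth_L oO hF) Up) (hderiveE oO (smooth_F hF) Up).
exact: smooth_derive_sqr (smooth_F hF) Up.
Qed.

(** The geodesic with initial velocity [y] runs on a line, so its acceleration at [0], and hence the
    spray, is a multiple of [y]. The factor is identified by [derive_spray] together with Euler's
    relation for [L]. *)
Lemma spray_proj_factor p : U p -> spray F p = proj_factor F p *: p.2.
Proof.
case: p => x y Up; have [Ox y0] := Up; rewrite /= in Ox y0.
have [d d0 [c [gc c0 c1]]] := geodesic_through Up.
have [[_ oI _] _ dc _ Ec] := gc.
have zI : [set t : R | `|t| < d] 0 by rewrite /= normr0.
have [dc0 ddc0] := dc 0 zI.
have y0' : derive1 c 0 != 0 by rewrite c1.
have [j yj Hc] := straight_curve oI zI dc0 y0' (pflat gc).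
(* The velocity moves on the line through [0] spanned by its value at time [0], so [derive1_on_line]
   applies a second time, now to [derive1 c]. *)
have H1 s : [set t : R | `|t| < d] s -> derive1 c s =
    0 + ((derive1 c s 0 j - 0) * (derive1 c 0 0 j)^-1) *: derive1 c 0.
  move=> sd; rewrite subr0 add0r.
  exact: derive1_on_line oI sd (dc s sd).1 Hc.
have H2 := derive1_on_line oI zI ddc0 H1.
have := Ec 0 zI; rewrite H2 c0 c1; set k := _ * _ => /eqP.
rewrite addrC addr_eq0 -scaleNr => /eqP E.
have {}E : spray F (x, y) = (- (k / 2)) *: y.
  have two0 : (2 : R) != 0 by rewrite pnatr_eq0.
  by apply: (scalerI two0); rewrite E scalerA mulrN mulrCA mulfV// mulr1.
have SL := smooth_L oO hF.
have := derive_spray oO hF Up; rewrite hderive_L// E pair0Z => E1.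
have E2 := smooth_deriveZv (0, y) (- (k / 2)) SL Up.
have E3 := euler (homogeneous_L hF) SL Up.
have {E1 E2 E3} : - (k / 2) * (2 * L (x, y)) = 2^-1 * (2 * F (x, y) * hderive F (x, y)).
  exact: etrans (congr1 (fun z => - (k / 2) * z) (esym E3)) (etrans (esym E2) E1).
have F0 := F_gt0 hF Up; rewrite /sqF => E4; congr (_ *: _).
rewrite /proj_factor -/(hderive F (x, y)); move: E4 F0.
move: (F (x, y)) (hderive F (x, y)) (- (k / 2)) => f h l E4 f0.
apply: (mulIf (lt0r_neq0 (mulr_gt0 (ltr0Sn _ 1) f0))).
rewrite divfK ?gt_eqF ?mulr_gt0//.
apply: (mulIf (lt0r_neq0 f0)); move: E4; rewrite expr2 => E4; nra.
Qed.

End Geodesics.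

(** * The equations of the projective factor *)

Section ProjectiveFactor.
Context {R : realType} {n : nat}.
Local Notation V := 'rV[R]_n.
Variables (Omega : set V) (oO : open Omega) (F : V * V -> R).
Hypothesis hF : finsler_metric Omega F.
Hypothesis pflat : projectively_flat Omega F.
Local Notation U := (slit Omega).
Local Notation L := (sqF F).
Local Notation P := (proj_factor F).
Implicit Types (p : V * V) (v w x y : V).

Let oU : open U := open_slit oO.
Let sF : smooth U F := smooth_F hF.
Let sL : smooth U L := smooth_L oO hF.

Lemma F_neq0 p : U p -> F p != 0.
Proof. by move=> Up; rewrite gt_eqF// (F_gt0 hF). Qed.

Lemma smooth_proj_factor : smooth U P.
Proof.
apply: (smooth_mul oU) (smooth_hderive oO sF) _.
apply: (smooth_inv oU); last exact: (smooth_mul oU (smooth_cst _ 2) sF).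
by move=> p Up; rewrite mulf_neq0 ?pnatr_eq0// F_neq0.
Qed.
Let sP : smooth U P := smooth_proj_factor.

Lemma hderive_F p : U p -> hderive F p = 2 * (P p * F p).
Proof.
move=> Up; have F0 := F_neq0 Up; rewrite /proj_factor -/(hderive F p).
by move: (hderive F p) (F p) F0 => h f f0; field.
Qed.

Lemma homogeneous_proj_factor : fibre_homogeneous Omega 1 P.
Proof.
move=> a x y a0 Up; have Uay := slit_scale a0 Up.
have H := fibre_homogeneous_hderive oO (homogeneous_F hF) sF a0 Up.
rewrite (hderive_F Uay) (hderive_F Up) (homogeneous_F hF a0 Up) in H.
have F0 := F_neq0 Up; move: H F0.
move: (F (x, y)) (P (x, y)) (P (x, a *: y)) => f b b' H F0.
have K0 : 2 * a * f != 0 by rewrite !mulf_neq0 ?pnatr_eq0// gt_eqF.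
by apply: (mulfI K0); apply: etrans _ (etrans H _); ring.
Qed.

(** The contraction of [w] with the spray is evaluated twice, by [bilin_spray] and by [G = P y].
    After substituting [L = F^2] the terms in [P] cancel and a factor [F] divides out. *)
Lemma hamel p w : U p -> hderive ('D_(0, w) F) p = 'D_(w, 0) F p.
Proof.
move=> Up.
have H1 : bilin (gmx F p) w (spray F p) = P p * (2^-1 * 'D_(0, w) L p).
  rewrite (spray_proj_factor oO hF pflat Up) (bilin_gmxC oO hF _ _ Up) bilinZl.
  by rewrite (bilin_gmx_y oO hF _ Up).
rewrite (bilin_spray oO hF w Up) in H1.
have sw := smooth_derive (0, w) sF.
have E1 : 'D_(0, w) L p = 2 * F p * 'D_(0, w) F p.
  exact: smooth_derive_sqr sF Up.
have E2 : 'D_(w, 0) L p = 2 * F p * 'D_(w, 0) F p.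
  exact: smooth_derive_sqr sF Up.
have E3 : hderive ('D_(0, w) L) p =
    2 * (F p * hderive ('D_(0, w) F) p + 'D_(0, w) F p * (2 * (P p * F p))).
  have S1 := smooth_mul oU sF sw.
  have D1 : hderive ('D_(0, w) L) p =
      'D_(p.2, 0) (fun q => 2 * (F q * 'D_(0, w) F q)) p.
    rewrite (hderiveE oO (smooth_derive _ sL) Up).
    apply: (derive_eq_on _ oU Up) => q Uq.
    exact: etrans (smooth_derive_sqr _ sF Uq) (esym (mulrA _ _ _)).
  rewrite -(hderive_F Up) (hderiveE oO sF Up) (hderiveE oO sw Up).
  have D2 := smooth_deriveZ (p.2, 0) 2 S1 Up.
  have D3 := smooth_deriveM (p.2, 0) sF sw Up.
  exact: etrans D1 (etrans D2 (congr1 (fun z => 2 * z) D3)).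
rewrite E1 E2 E3 in H1; have F0 := F_neq0 Up; clear - H1 F0.
apply: (mulfI F0); move: H1.
move: (F p) (hderive _ p) ('D_(w, 0) F p) ('D_(0, w) F p) (P p) => f h a b c H1.
lra.
Qed.

Definition proj_mul p := P p * F p.
Local Notation PF := proj_mul.

Let sPF : smooth U PF := smooth_mul oU sP sF.

(** Differentiating [y^k F_{x^k} = 2 P F] along the fibre produces the base derivative of [F] twice,
    once from the commutator in [derive_hderive] and once from [hamel]. *)
Lemma derive_base_F p w : U p -> 'D_(w, 0) F p = 'D_(0, w) PF p.
Proof.
move=> Up; have E1 := derive_hderive oO w sF Up; rewrite (hamel w Up) in E1.
have E2 : 'D_(0, w) (hderive F) p = 'D_(0, w) (fun q => 2 * PF q) p.
  by apply: (derive_eq_on _ oU Up) => q Uq; exact: hderive_F.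
have E3 := smooth_deriveZ (0, w) 2 sPF Up.
have := etrans (esym E1) (etrans E2 E3).
move: ('D_(_, _) F p) ('D_(_, _) PF p) => a b; lra.
Qed.

Lemma derive_fibre_PF p w : U p ->
  'D_(0, w) PF p = P p * 'D_(0, w) F p + F p * 'D_(0, w) P p.
Proof. by move=> Up; exact: smooth_deriveM sP sF Up. Qed.

Lemma derive_base_hderive f p w : smooth U f -> U p ->
  'D_(w, 0) (hderive f) p = hderive ('D_(w, 0) f) p.
Proof.
move=> sf Up.
have sk k : smooth U (fun q => q.2 0 k * 'D_(ebase k, 0) f q).
  by apply: (smooth_mul oU (smooth_snd_coord Omega k)); exact: smooth_derive.
apply: (etrans (smooth_derive_sum oU _ (w, 0) sk Up)).
apply: eq_bigr => k _.
have E1 := smooth_deriveM (w, 0) (smooth_snd_coord Omega k)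
  (smooth_derive (ebase k, 0) sf) Up.
have E2 := derive_snd_coord p (w, 0) k; rewrite mxE in E2.
have E3 := smooth_comm oU (ebase k, 0) (w, 0) sf Up.
apply: (etrans E1); apply: (etrans (congr2 (fun a b => p.2 0 k * a + _ * b) E3 E2)).
by rewrite mulr0 addr0.
Qed.

Lemma hderive_eq_on f g p : smooth U f -> smooth U g -> U p ->
  (forall q, U q -> f q = g q) -> hderive f p = hderive g p.
Proof.
move=> sf sg Up fg; rewrite (hderiveE oO sf Up) (hderiveE oO sg Up).
exact: derive_eq_on oU Up fg.
Qed.

(* This replaces the integrability condition [F_{x^k x^l} = F_{x^l x^k}]: since
   [hderive F = 2 P F] and [F_{x^k} = (P F)_{y^k}], the field [hderive] applied to the
   latter equation only involves first derivatives of [P F]. *)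
Lemma derive_fibre_hderive_PF p w : U p ->
  'D_(0, w) (hderive PF) p = 3 * 'D_(w, 0) PF p.
Proof.
move=> Up; apply: (etrans (derive_hderive oO w sPF Up)).
have E1 : hderive ('D_(0, w) PF) p = hderive ('D_(w, 0) F) p.
  apply: hderive_eq_on => //; [exact: smooth_derive|exact: smooth_derive|].
  by move=> q Uq; exact: esym (derive_base_F w Uq).
have E2 := esym (derive_base_hderive w sF Up).
have E3 : 'D_(w, 0) (hderive F) p = 'D_(w, 0) (fun q => 2 * PF q) p.
  by apply: (derive_eq_on _ oU Up) => q Uq; exact: hderive_F.
have E4 := smooth_deriveZ (w, 0) 2 sPF Up.
have := etrans E1 (etrans E2 (etrans E3 E4)).
move: (hderive _ _) ('D_(_, _) PF p) => a b ->; ring.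
Qed.

Section ConstantXi.
Variable (lambda : R).
Hypothesis hcurv : forall p, U p -> hderive P p = P p ^+ 2 - lambda * F p ^+ 2.

Lemma hderive_PF p : U p -> hderive PF p = 3 * (P p ^+ 2 * F p) - lambda * (F p ^+ 2 * F p).
Proof.
move=> Up; rewrite (hderiveE oO sPF Up).
apply: (etrans (smooth_deriveM (p.2, 0) sP sF Up)).
rewrite -(hderiveE oO sF Up) -(hderiveE oO sP Up) hcurv// hderive_F//.
move: (P p) (F p) => a b; ring.
Qed.

(** The fibre derivative of [hderive_PF] is compared with [derive_fibre_hderive_PF]. Expanding with
    [F_x = (P F)_y], the terms [P^2 F_y] cancel and a factor [F] divides out. *)
Lemma derive_base_P p w : U p ->
  'D_(w, 0) P p = P p * 'D_(0, w) P p - lambda * (F p * 'D_(0, w) F p).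
Proof.
move=> Up; have E1 := derive_fibre_hderive_PF w Up.
have sP2 := smooth_sqr oU sP; have sF2 := smooth_sqr oU sF.
have sA := smooth_mul oU sP2 sF; have sB := smooth_mul oU sF2 sF.
have sA' := smooth_mul oU (smooth_cst U 3) sA.
have sB' := smooth_mul oU (smooth_cst U lambda) sB.
have E2 : 'D_(0, w) (hderive PF) p =
   'D_(0, w) (fun q => 3 * (P q ^+ 2 * F q) - lambda * (F q ^+ 2 * F q)) p.
  by apply: (derive_eq_on _ oU Up) => q Uq; exact: hderive_PF.
have E3 := smooth_deriveB (0, w) sA' sB' Up.
have E4 := smooth_deriveZ (0, w) 3 sA Up.
have E5 := smooth_deriveZ (0, w) lambda sB Up.
have E6 := smooth_deriveM (0, w) sP2 sF Up.
have E7 := smooth_deriveM (0, w) sF2 sF Up.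
have E8 := smooth_derive_sqr (0, w) sP Up.
have E9 := smooth_derive_sqr (0, w) sF Up.
have EE : 3 * 'D_(w, 0) PF p =
   3 * (P p ^+ 2 * 'D_(0, w) F p + F p * (2 * P p * 'D_(0, w) P p)) -
   lambda * (F p ^+ 2 * 'D_(0, w) F p + F p * (2 * F p * 'D_(0, w) F p)).
  apply: (etrans (esym E1)); apply: (etrans E2); apply: (etrans E3).
  apply: (congr2 (fun a b => a - b)).
    apply: (etrans E4); apply: (congr1 (fun z => 3 * z)).
    by apply: (etrans E6); apply: (congr1 (fun z => _ + F p * z)); exact: E8.
  apply: (etrans E5); apply: (congr1 (fun z => lambda * z)).
  by apply: (etrans E7); apply: (congr1 (fun z => _ + F p * z)); exact: E9.
have E10 : 'D_(w, 0) PF p = P p * 'D_(w, 0) F p + F p * 'D_(w, 0) P p.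
  exact: smooth_deriveM sP sF Up.
have E11 := etrans (derive_base_F w Up) (derive_fibre_PF w Up).
have F0 := F_neq0 Up; move: EE; rewrite E10 E11; clear - F0.
move: (F p) ('D_(w, 0) P p) ('D_(0, w) F p) ('D_(0, w) P p) (P p) F0 => f a b c d f0 H.
apply: (mulfI f0); lra.
Qed.

End ConstantXi.
End ProjectiveFactor.

(** * Flag curvature *)

Section RiemannAlgebra.
Context {R : realType} {n : nat}.

Lemma exists_neq_ord (j : 'I_n) : (2 <= n)%N -> exists i : 'I_n, i != j.
Proof.
move=> n2; have [i ij|H] := pickP (fun i : 'I_n => i != j); first by exists i.
have : (#|'I_n| <= 1)%N.
  by apply/fintype_le1P => a b; rewrite (eqP (negbFE (H a))) (eqP (negbFE (H b))).
by rewrite card_ord leqNgt n2.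
Qed.

Lemma sum_delta (i : 'I_n) (a : 'I_n -> R) : \sum_j a j * (i == j)%:R = a i.
Proof.
rewrite (bigD1 i)//= big1 ?addr0 => [|j ji]; first by rewrite eqxx mulr1.
by rewrite eq_sym (negbTE ji) mulr0.
Qed.

(** Berwald's formula for [G^i = P y^i] at one point: [Q] stands for the value of [P], [d] and [b]
    for its fibre and base derivatives, [dyy] and [dxy] for the second ones. With Euler's relation
    every term is a multiple of the identity or of [y i]. *)
Lemma riemann_algebra (Q : R) (y d b : 'I_n -> R) (dxy dyy : 'I_n -> 'I_n -> R) i k :
  \sum_j y j * d j = Q ->
  2 * (y i * b k) - (\sum_j y j * (b j * (i == k)%:R + y i * dxy j k)) +
  2 * (\sum_j Q * y j * (d k * (i == j)%:R + (d j * (i == k)%:R + y i * dyy j k))) -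
  (\sum_j (Q * (i == j)%:R + y i * d j) * (Q * (j == k)%:R + y j * d k)) =
  (Q ^+ 2 - \sum_j y j * b j) * (i == k)%:R +
  y i * (2 * b k - (\sum_j y j * dxy j k) + 2 * Q * (\sum_j y j * dyy j k) - Q * d k).
Proof.
move=> euler1.
have S1 : \sum_j y j * (b j * (i == k)%:R + y i * dxy j k) =
    (\sum_j y j * b j) * (i == k)%:R + y i * (\sum_j y j * dxy j k).
  rewrite mulr_suml mulr_sumr -big_split/=; apply: eq_bigr => j _; ring.
have S2 : \sum_j Q * y j * (d k * (i == j)%:R + (d j * (i == k)%:R + y i * dyy j k)) =
    Q * (d k * y i) + Q * (i == k)%:R * (\sum_j y j * d j) +
    Q * y i * (\sum_j y j * dyy j k).
  rewrite -[in Q * (d k * _)](sum_delta i y) !mulr_sumr -!big_split/=.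
  by apply: eq_bigr => j _; ring.
have S3 : \sum_j (Q * (i == j)%:R + y i * d j) * (Q * (j == k)%:R + y j * d k) =
    Q ^+ 2 * (i == k)%:R + Q * d k * y i + Q * y i * d k +
    y i * d k * (\sum_j y j * d j).
  rewrite -(sum_delta i (fun j => (j == k)%:R)) -[in Q * d k * _](sum_delta i y).
  rewrite -[in Q * y i * _](sum_delta k d) !mulr_sumr -!big_split/=.
  apply: eq_bigr => j _; rewrite (eq_sym k); ring.
rewrite S1 S2 S3 euler1; ring.
Qed.

End RiemannAlgebra.

Section Curvature.
Context {R : realType} {n : nat}.
Local Notation V := 'rV[R]_n.
Variables (Omega : set V) (oO : open Omega) (F : V * V -> R).
Hypothesis hF : finsler_metric Omega F.
Hypothesis pflat : projectively_flat Omega F.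
Local Notation U := (slit Omega).
Local Notation L := (sqF F).
Local Notation P := (proj_factor F).
Implicit Types (p : V * V) (v w x y : V).

Let oU : open U := open_slit oO.
Let sP : smooth U P := smooth_proj_factor oO hF.

Lemma spray_coefE i p : U p -> spray_coef F i p = P p * p.2 0 i.
Proof.
move=> Up; have := spray_proj_factor oO hF pflat Up.
by move=> /(congr1 (fun v : V => v 0 i)); rewrite /spray !mxE.
Qed.

Lemma derive_mul_coord f p (u : V * V) i : smooth U f -> U p ->
  'D_u (fun q => f q * q.2 0 i) p = f p * u.2 0 i + p.2 0 i * 'D_u f p.
Proof.
move=> sf Up; have E := smooth_deriveM u sf (smooth_snd_coord Omega i) Up.
exact: etrans E (congr1 (fun z => f p * z + _) (derive_snd_coord p u i)).
Qed.

Lemma derive_spray_coef i p (u : V * V) : U p ->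
  'D_u (spray_coef F i) p = P p * u.2 0 i + p.2 0 i * 'D_u P p.
Proof.
move=> Up; apply: etrans (derive_mul_coord u i sP Up).
by apply: (derive_eq_on _ oU Up) => q Uq; exact: spray_coefE.
Qed.

Lemma derive2_spray_coef i p (u u' : V * V) : U p ->
  'D_u' ('D_u (spray_coef F i)) p =
  'D_u' P p * u.2 0 i + ('D_u P p * u'.2 0 i + p.2 0 i * 'D_u' ('D_u P) p).
Proof.
move=> Up; have sDP := smooth_derive u sP.
have sPu : smooth U (fun q => u.2 0 i * P q) := smooth_mul oU (smooth_cst U _) sP.
have sDPc := smooth_mul oU sDP (smooth_snd_coord Omega i).
have E1 : 'D_u' ('D_u (spray_coef F i)) p =
    'D_u' (fun q => u.2 0 i * P q + 'D_u P q * q.2 0 i) p.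
  apply: (derive_eq_on _ oU Up) => q Uq; apply: (etrans (derive_spray_coef i u Uq)).
  by rewrite (mulrC (P q)) (mulrC (q.2 0 i)).
apply: (etrans E1); apply: (etrans (smooth_deriveD u' sPu sDPc Up)).
apply: (congr2 +%R).
  by apply: (etrans (smooth_deriveZ u' (u.2 0 i) sP Up)); exact: mulrC.
exact: derive_mul_coord sDP Up.
Qed.

Lemma ebase_coord (k i : 'I_n) : (ebase k : V) 0 i = (i == k)%:R.
Proof. by rewrite mxE eqxx. Qed.

Lemma riemann_proj_factor p : U p -> exists tau : 'I_n -> R, forall i k,
  riemann_mx F p i k = (P p ^+ 2 - hderive P p) * (i == k)%:R + p.2 0 i * tau k.
Proof.
move=> Up; pose d k := 'D_(0, ebase k) P p.
pose b k := 'D_(ebase k, 0) P p.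
pose dxy j k := 'D_(0, ebase k) ('D_(ebase j, 0) P) p.
pose dyy j k := 'D_(0, ebase k) ('D_(0, ebase j) P) p.
pose y j := p.2 0 j.
have euler1 : \sum_j y j * d j = P p.
  have := euler (homogeneous_proj_factor oO hF) sP Up.
  by rewrite mul1r (derive_dyE oO p.2 sP Up).
have z0 i : (0 : V) 0 i = 0 by rewrite mxE.
have Gy i j : dy j (spray_coef F i) p = P p * (i == j)%:R + y i * d j.
  apply: (etrans (derive_spray_coef i (0, ebase j) Up)).
  by rewrite /= ebase_coord.
have Gx i j : dx j (spray_coef F i) p = y i * b j.
  apply: (etrans (derive_spray_coef i (ebase j, 0) Up)).
  by rewrite /= z0 mulr0 add0r.
have Gxy i j k : dy k (dx j (spray_coef F i)) p =
    b j * (i == k)%:R + y i * dxy j k.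
  apply: (etrans (derive2_spray_coef i (ebase j, 0) (0, ebase k) Up)).
  by rewrite /= z0 mulr0 add0r ebase_coord.
have Gyy i j k : dy k (dy j (spray_coef F i)) p =
    d k * (i == j)%:R + (d j * (i == k)%:R + y i * dyy j k).
  apply: (etrans (derive2_spray_coef i (0, ebase j) (0, ebase k) Up)).
  by rewrite /= !ebase_coord.
have G0 j := spray_coefE j Up.
exists (fun k => 2 * b k - (\sum_j y j * dxy j k) +
  2 * P p * (\sum_j y j * dyy j k) - P p * d k) => i k.
apply: etrans (riemann_algebra b dxy dyy i k euler1).
rewrite mxE; apply: (congr2 (fun a b => a - b)); first apply: (congr2 +%R).
- apply: (congr2 (fun a b => a - b)); first by rewrite Gx.
  by apply: eq_bigr => j _; rewrite Gxy.
- by congr (2 * _); apply: eq_bigr => j _; rewrite Gyy G0.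
- by apply: eq_bigr => j _; rewrite !Gy.
Qed.

Lemma exists_orthogonal p : (2 <= n)%N -> U p ->
  exists u, u != 0 /\ bilin (gmx F p) u p.2 = 0.
Proof.
move=> n2 Up; have y0 : p.2 != 0 by case: Up.
have [j yj] : exists j, p.2 0 j != 0 by exact/rV0Pn.
have [i ij] := exists_neq_ord j n2.
have Lp : 0 < L p by rewrite /sqF exprn_gt0// (F_gt0 hF).
pose v : V := ebase i.
(* Gram-Schmidt against [y] for the inner product [g], with [g (y, y) = L]. *)
pose c := bilin (gmx F p) v p.2 / L p.
exists (v - c *: p.2); split; last first.
  rewrite -scaleNr bilinDl bilinZl (bilin_gmx_yy oO hF Up) /c.
  by rewrite mulNr divfK ?subrr// gt_eqF.
(* If the difference vanished, its coordinate [j] would force [c = 0], and its coordinate [i] would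
   then read [1 = 0]. *)
apply: contraTneq isT => /(congr1 (fun w : V => (w 0 j, w 0 i))).
rewrite !mxE !eqxx/= (eq_sym j) (negbTE ij) => -[/eqP + /eqP].
rewrite sub0r oppr_eq0 mulf_eq0 (negbTE yj) orbF => /eqP ->.
by rewrite mul0r subr0 oner_eq0.
Qed.

(* For a flag edge [u] orthogonal to [y] the [y^i tau_k] part of the Riemann
   curvature does not contribute. *)
Lemma constant_flag_curvature_hderive lambda : (2 <= n)%N ->
  constant_flag_curvature Omega F lambda ->
  forall p, U p -> hderive P p = P p ^+ 2 - lambda * F p ^+ 2.
Proof.
move=> n2 hK p Up; have [u [u0 uy]] := exists_orthogonal n2 Up.
have guu := posdef_gmx hF Up u0.
have Lp : 0 < L p by rewrite /sqF exprn_gt0// (F_gt0 hF).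
(* Pairing a vanishing combination with [u] removes the [y] term by orthogonality and forces the
   coefficient of [u] to be [0]. *)
have free : row_free (col_mx p.2 u).
  rewrite -kermx_eq0; apply/rowV0P => w /sub_kermxP.
  rewrite -[w]hsubmxK mul_row_col; set a := lsubmx w; set b := rsubmx w.
  rewrite [a]mx11_scalar [b]mx11_scalar !mul_scalar_mx.
  move: (a 0 0) (b 0 0) => s t H.
  have t0 : t = 0.
    have := congr1 (fun z => bilin (gmx F p) z u) H.
    rewrite bilinDl !bilinZl (bilin_gmxC oO hF _ _ Up) uy mulr0 add0r.
    rewrite {2}/bilin !mul0mx mxE => /eqP; rewrite mulf_eq0 (gt_eqF guu) orbF.
    by move/eqP.
  have s0 : s = 0.
    move/eqP: H; rewrite t0 scale0r addr0 scaler_eq0.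
    by case: Up => _ /negbTE ->; rewrite orbF => /eqP.
  rewrite s0 t0; apply/rowP => l; rewrite !mxE.
  by case: (fintype.split l) => l'; rewrite !mxE mul0rn.
have [tau Rtau] := riemann_proj_factor Up.
have := hK p.1 p.2 u (proj1 Up) free.
rewrite /flag_curvature -surjective_pairing => E.
set xi := P p ^+ 2 - hderive P p in Rtau.
have Ru : u *m (riemann_mx F p)^T = xi *: u + (\sum_k u 0 k * tau k) *: p.2.
  apply/rowP => i; rewrite !mxE.
  transitivity (\sum_k (xi * (u 0 k * (i == k)%:R) + u 0 k * tau k * p.2 0 i)).
    by apply: eq_bigr => k _; rewrite mxE Rtau; ring.
  by rewrite big_split/= -mulr_sumr sum_delta -mulr_suml.
rewrite Ru bilinDl !bilinZl (bilin_gmxC oO hF p.2 u Up) uy in E.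
rewrite (bilin_gmx_yy oO hF Up) mulr0 addr0 expr0n/= subr0 in E.
have : xi = lambda * L p.
  rewrite -E; move: (bilin _ u u) (L p) guu Lp => g l g0 l0.
  by field; rewrite !gt_eqF.
by rewrite /xi /sqF; lra.
Qed.

End Curvature.

(** * Linear ODEs and the Burgers equation *)

Section LinearODE.
Context {R : realType}.

(* For [|k| <= M], [g ^ 2 exp (-2 M t)] is nonincreasing and [g ^ 2 exp (2 M t)]
   is nondecreasing. *)
Lemma linear_ode_zero (g k : R -> R) (a b t0 : R) :
  a <= t0 <= b ->
  (forall t, a <= t <= b -> is_derive t 1 g (k t * g t)) ->
  (forall t, a <= t <= b -> {for t, continuous k}) ->
  g t0 = 0 -> forall t, a <= t <= b -> g t = 0.
Proof.
move=> t0ab dg ck g0 t tab.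
have [M HM] : exists M, forall s, a <= s <= b -> `|k s| <= M.
  have ab : a <= b by case/andP: t0ab; exact: le_trans.
  have cw : {within `[a, b], continuous (fun s => `|k s|)}.
    apply: continuous_in_subspaceT => s; rewrite inE/= in_itv/= => sab.
    by apply: (@continuous_comp _ _ _ k Num.norm); [exact: ck|exact: norm_continuous].
  have [m _ Hm] := EVT_max ab cw.
  by exists `|k m| => s sab; apply: Hm; rewrite in_itv.
have key (s u : R) : (forall r, Num.min s u <= r <= Num.max s u -> a <= r <= b) ->
    g s = 0 -> g u = 0.
  move=> sub gs.
  (* The sign makes [h] nonincreasing on the way from [s] to [u], whichever of the two is larger, so
     that [h u <= h s = 0]. *)
  pose sg : R := if s <= u then -1 else 1.
  pose h r := g r ^+ 2 * expR (2 * M * sg * r).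
  pose dh r := 2 * g r ^+ 2 * (k r + M * sg) * expR (2 * M * sg * r).
  have dhP r : a <= r <= b -> is_derive r 1 h (dh r).
    move=> rab; have D1 := dg r rab.
    have D2 : is_derive r 1 (fun r => g r ^+ 2) (2 * g r * (k r * g r)).
      have := @is_deriveX R R g 2 r 1 _ D1; rewrite expr1.
      by move=> D; apply: is_derive_eq D _; rewrite /GRing.scale/=.
    have D3 : is_derive r 1 (fun r => 2 * M * sg * r) (2 * M * sg).
      have := @is_deriveZ R R R id (2 * M * sg) r 1 1 _.
      by rewrite /GRing.scale/= mulr1; apply.
    have D4 : is_derive r 1 (fun r => expR (2 * M * sg * r))
        (expR (2 * M * sg * r) * (2 * M * sg)).
      exact: (@is_derive1_comp _ expR _ r _ _ (is_derive_expR _) D3).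
    have D5 := @is_deriveM R R _ _ r 1 _ _ D2 D4.
    apply: is_derive_eq D5 _; rewrite /dh /GRing.scale/=.
    by move: (expR _) => e; ring.
  have dh_sign r : a <= r <= b -> 0 <= - sg * - dh r.
    move=> rab; have := HM r rab; rewrite ler_norml => /andP[k1 k2].
    have e0 := expR_ge0 (2 * M * sg * r); rewrite mulrNN /dh.
    have -> : sg * (2 * g r ^+ 2 * (k r + M * sg) * expR (2 * M * sg * r)) =
      2 * g r ^+ 2 * expR (2 * M * sg * r) * (sg * k r + M * sg ^+ 2) by ring.
    apply: mulr_ge0; first by rewrite mulr_ge0// mulr_ge0// sqr_ge0.
    by rewrite /sg; case: ifP => _; rewrite ?sqrrN expr1n; lra.
  have hs : h s = 0 by rewrite /h gs expr0n mul0r.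
  have hu : h u <= 0.
    have [su|us] := leP s u.
      have [r|r|r] := @MVT_segment R h dh s u su.
      - rewrite in_itv/= => /andP[sr ru]; apply/dhP/sub.
        by rewrite (min_idPl su) (max_idPr su) !ltW.
      - apply: (@derivable_within_continuous _ _ _ `[s, u]) r => r.
        rewrite in_itv/= => sru; have [] // := dhP r _.
        by apply: sub; rewrite (min_idPl su) (max_idPr su).
      - rewrite in_itv/= => sru; rewrite hs subr0 => ->.
        have := dh_sign r; rewrite /sg su !mulNr !mul1r !opprK oppr_ge0.
        move=> /(_ (sub r _)); rewrite (min_idPl su) (max_idPr su) => /(_ sru).
        by move=> d0; rewrite mulr_le0_ge0// subr_ge0.
    have us' := ltW us.
    have [r|r|r] := @MVT_segment R h dh u s us'.
    - rewrite in_itv/= => /andP[sr ru]; apply/dhP/sub.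
      by rewrite (min_idPr us') (max_idPl us') !ltW.
    - apply: (@derivable_within_continuous _ _ _ `[u, s]) r => r.
      rewrite in_itv/= => sru; have [] // := dhP r _.
      by apply: sub; rewrite (min_idPr us') (max_idPl us').
    - rewrite in_itv/= => sru; rewrite hs sub0r => E.
      have sg1 : sg = 1 by rewrite /sg leNgt us.
      have := dh_sign r; rewrite sg1 mulrNN mul1r.
      move=> /(_ (sub r _)); rewrite (min_idPr us') (max_idPl us') => /(_ sru).
      move=> d0; rewrite -oppr_ge0 E mulr_ge0// subr_ge0//.
  have : h u = 0.
    apply/eqP; rewrite eq_le hu mulr_ge0 ?sqr_ge0 ?expR_ge0//.
  move/eqP; rewrite /h mulf_eq0 (gt_eqF (expR_gt0 _)) orbF sqrf_eq0.
  by move/eqP.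
apply: (key t0) g0 => r /andP[].
case/andP: t0ab => h1 h2; case/andP: tab => h3 h4.
rewrite ge_min le_max => /orP r1 /orP r2; apply/andP; split.
  by case: r1; apply: le_trans.
by case: r2 => h; apply: le_trans h _.
Qed.

End LinearODE.

(** * Characteristics of the Burgers equation *)

Section Burgers.
Context {R : realType} {n : nat}.
Local Notation V := 'rV[R]_n.
Variables (Omega : set V) (oO : open Omega).
Local Notation U := (slit Omega).
Implicit Types (f g : V * V -> R) (p : V * V) (v w x y z : V).

Let oU : open U := open_slit oO.

Definition burgers f := smooth U f /\
  forall p w, U p -> 'D_(w, 0) f p = f p * 'D_(0, w) f p.

Definition char_line x z (c : R) (t : R) : V * V := (t *: x, z - (t * c) *: x).

Lemma char_lineE x z c t : char_line x z c t = (0, z) + t *: (x, - c *: x).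
Proof.
apply: injective_projections; rewrite /= ?add0r//.
by rewrite scalerA mulrN scaleNr.
Qed.

Lemma is_derive_char_line f x z c t : smooth U f -> U (char_line x z c t) ->
  is_derive t 1 (fun s => f (char_line x z c s))
    ('D_(x, 0) f (char_line x z c t) - c * 'D_(0, x) f (char_line x z c t)).
Proof.
move=> sf Up.
have E : (fun s => f (char_line x z c s)) = (fun s => f ((0, z) + s *: (x, - c *: x))).
  by apply/funext => s; rewrite char_lineE.
have D : derivable f ((0, z) + t *: (x, - c *: x)) (x, - c *: x).
  by rewrite -char_lineE; exact: (smooth_derivable sf Up).
have DL := is_derive_line D.
rewrite -char_lineE in DL; rewrite E; apply: is_derive_eq DL _.
have -> : (x, - c *: x) = (x, 0) + (- c) *: (0, x) :> V * V.
  by apply: injective_projections; rewrite /= ?scaler0 ?addr0 ?add0r.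
apply: (etrans (smooth_deriveDv oU _ _ sf Up)).
have E2 := smooth_deriveZv (0, x) (- c) sf Up; rewrite mulNr in E2.
exact: (congr1 (fun u => 'D_(x, 0) f (char_line x z c t) + u) E2).
Qed.

Lemma continuous_char_line f x z c t : {for char_line x z c t, continuous f} ->
  {for t, continuous (fun s => f (char_line x z c s))}.
Proof.
move=> cf; apply: (@continuous_comp _ _ _ (char_line x z c) f) => //.
rewrite (_ : char_line x z c = fun s => (0, z) + s *: (x, - c *: x)); last first.
  by apply/funext => s; exact: char_lineE.
apply: cvgD; first exact: cvg_cst.
exact: scalel_continuous.
Qed.

(* Solutions are constant along the straight line whose slope is their value at
   one of its points: the deviation from that value solves a linear ODE. *)
Lemma burgers_constant f x z c t0 : burgers f ->
  (forall t, 0 <= t <= 1 -> U (char_line x z c t)) ->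
  0 <= t0 <= 1 -> f (char_line x z c t0) = c ->
  forall t, 0 <= t <= 1 -> f (char_line x z c t) = c.
Proof.
move=> [sf bf] Ul t01 ft0 t t1; apply/eqP; rewrite -subr_eq0; apply/eqP.
pose k s := 'D_(0, x) f (char_line x z c s).
apply: (@linear_ode_zero R (fun s => f (char_line x z c s) - c) k 0 1 t0) => //.
- move=> s s01; have Us := Ul s s01.
  have D := is_derive_char_line sf Us.
  have D2 := @is_deriveB R R R _ (fun=> c) s 1 _ 0 D (is_derive_cst _ _ _).
  apply: is_derive_eq D2 _; rewrite subr0 -/(k s) bf// -/(k s).
  by rewrite -mulrBl mulrC.
- move=> s s01; apply: (@continuous_char_line ('D_(0, x) f)).
  exact: smooth_continuous (smooth_derive (0, x) sf) (Ul s s01).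
- by rewrite ft0 subrr.
Qed.

(** The line through [(x, y)] for the value [c = g (x, y)] is followed back to the fibre over [0],
    where [f] and [g] agree; from there [f] is carried forward with the value [c]. The condition on
    [y] keeps this line off the zero section. *)
Lemma burgers_unique f g x y : burgers f -> burgers g ->
  (forall t : R, 0 <= t <= 1 -> Omega (t *: x)) -> (forall h : R, y + h *: x != 0) ->
  (forall z, f (0, z) = g (0, z)) -> f (x, y) = g (x, y).
Proof.
move=> bf bg star npar f0; set c := g (x, y).
pose z := y + c *: x.
have E1 : char_line x z c 1 = (x, y).
  by rewrite /char_line scale1r mul1r /z addrK.
have Ul t : 0 <= t <= 1 -> U (char_line x z c t).
  move=> t01; split; first exact: star.
  by rewrite /= /z -addrA -scalerBl; exact: npar.
have i0 : 0 <= (0 : R) <= 1 by rewrite lexx ler01.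
have i1 : 0 <= (1 : R) <= 1 by rewrite lexx ler01.
have E0 : char_line x z c 0 = (0, z).
  by rewrite /char_line mul0r !scale0r subr0.
have g1 : g (char_line x z c 1) = c by rewrite E1.
have g0 := burgers_constant bg Ul i1 g1 i0.
have f0c : f (char_line x z c 0) = c by rewrite E0 f0 -E0.
by have := burgers_constant bf Ul i0 f0c i1; rewrite E1.
Qed.

Lemma radial_line y s : char_line y y 0 s = (s *: y, y).
Proof. by rewrite /char_line mulr0 scale0r subr0. Qed.

Lemma is_derive_radial f y s : smooth U f -> U (s *: y, y) ->
  is_derive s 1 (fun t => f (t *: y, y)) ('D_(y, 0) f (s *: y, y)).
Proof.
move=> sf; rewrite -radial_line => Up.
have := is_derive_char_line sf Up; rewrite mul0r subr0.
by congr (is_derive _ _ _ _); apply/funext => t; rewrite radial_line.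
Qed.

(** Along the ray with fixed fibre vector [y], Euler's relation turns the equation into [f' = f^2].
    In product form the deviation solves a linear ODE, and [1 - f (0, y) * s] need not be known to
    be nonzero beforehand. *)
Lemma burgers_radial f y S : burgers f -> fibre_homogeneous Omega 1 f ->
  y != 0 -> 0 <= S -> (forall s, 0 <= s <= S -> Omega (s *: y)) ->
  forall s, 0 <= s <= S -> f (s *: y, y) * (1 - f (0, y) * s) = f (0, y).
Proof.
move=> [sf bf] hf y0 S0 OS s sS; set c := f (0, y).
apply/eqP; rewrite -subr_eq0; apply/eqP.
have UU r : 0 <= r <= S -> U (r *: y, y) by move=> /OS.
apply: (@linear_ode_zero R (fun s => f (s *: y, y) * (1 - c * s) - c)
  (fun s => f (s *: y, y)) 0 S 0) => //.
- by rewrite lexx.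
- move=> r rS; have D1 := is_derive_radial sf (UU r rS).
  have E : 'D_(y, 0) f (r *: y, y) = f (r *: y, y) * f (r *: y, y).
    have Ee := euler hf sf (UU r rS); rewrite mul1r in Ee.
    have Eb := bf (r *: y, y) y (UU r rS).
    exact: (etrans Eb (congr1 (fun u => f (r *: y, y) * u) Ee)).
  rewrite E in D1.
  have D2 : is_derive r 1 (fun s => 1 - c * s) (- c).
    have D3 := @is_deriveZ R R R id c r 1 1 (is_derive_id _ _).
    have D4 := @is_deriveB R R R (fun=> 1) _ r 1 0 _ (is_derive_cst _ _ _) D3.
    by apply: is_derive_eq D4 _; rewrite sub0r /GRing.scale/= mulr1.
  have D5 := @is_deriveM R R _ _ r 1 _ _ D1 D2.
  have D6 := @is_deriveB R R R _ (fun=> c) r 1 _ 0 D5 (is_derive_cst _ _ _).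
  apply: is_derive_eq D6 _; rewrite /GRing.scale/=.
  by move: (f (r *: y, y)) => a; ring.
- move=> r rS; have [D _] := is_derive_radial sf (UU r rS).
  exact/differentiable_continuous/derivable1_diffP.
- by rewrite scale0r mulr0 subr0 mulr1 subrr.
Qed.

(** Otherwise [f (0, y)] is positive and its inverse lies in [[0, S]], where [burgers_radial] reads
    [0 = f (0, y)]. *)
Lemma burgers_radial_gt0 f y S : burgers f -> fibre_homogeneous Omega 1 f ->
  y != 0 -> 0 <= S -> (forall s, 0 <= s <= S -> Omega (s *: y)) ->
  0 < 1 - f (0, y) * S.
Proof.
move=> bf hf y0 S0 OS; rewrite ltNge; apply/negP => le0.
have c0 : 0 < f (0, y).
  rewrite ltNge; apply/negP => c0; have := mulr_le0_ge0 c0 S0; lra.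
have inS : 0 <= (f (0, y))^-1 <= S.
  rewrite invr_ge0 ltW//= -[leLHS]mul1r ler_pdivrMr// mulrC; lra.
have := burgers_radial bf hf y0 S0 OS inS.
by rewrite mulfV ?gt_eqF// subrr mulr0 => E; rewrite -E ltxx in c0.
Qed.

End Burgers.

(** * Complete rays from the origin *)

Section FlatMetric.
Context {R : realType} {n : nat}.
Local Notation V := 'rV[R]_n.
Variables (Omega : set V) (oO : open Omega) (F : V * V -> R) (mu : R).
Hypothesis hF : finsler_metric Omega F.
Hypothesis pflat : projectively_flat Omega F.
Local Notation U := (slit Omega).
Local Notation P := (proj_factor F).
Hypothesis hcurv : forall p, U p -> hderive P p = P p ^+ 2 - (- mu ^+ 2) * F p ^+ 2.
Implicit Types (p : V * V) (v w x y z : V).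

Let oU : open U := open_slit oO.
Let sF : smooth U F := smooth_F hF.
Let sP : smooth U P := smooth_proj_factor oO hF.

Definition char_speed (s : R) p := P p + s * F p.

(** Adding [s] times [derive_base_F] to [derive_base_P] gives the right side
    [P P_y + mu^2 F F_y + s (P F_y + F P_y)], which factors as [(P + s F) (P + s F)_y] because
    [s^2 = mu^2]. *)
Lemma burgers_char_speed s : s ^+ 2 = mu ^+ 2 -> burgers Omega (char_speed s).
Proof.
move=> s2; have sB := smooth_mul oU (smooth_cst _ s) sF.
split; first exact: (smooth_add oU sP sB).
move=> p w Up.
have E1 := smooth_deriveD (w, 0) sP sB Up.
have E2 := smooth_deriveD (0, w) sP sB Up.
have E3 := smooth_deriveZ (w, 0) s sF Up.
have E4 := smooth_deriveZ (0, w) s sF Up.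
have E5 := derive_base_P oO hF pflat hcurv w Up.
have E6 := etrans (derive_base_F oO hF pflat w Up) (derive_fibre_PF oO hF w Up).
apply: (etrans E1); apply: (etrans (congr2 +%R E5 (etrans E3 (congr1 (fun u => s * u) E6)))).
apply: esym; apply: (etrans (congr1 (fun u => char_speed s p * u)
  (etrans E2 (congr1 (fun u => 'D_(0, w) P p + u) E4)))).
rewrite /char_speed -s2.
by move: ('D_(0, w) P p) ('D_(0, w) F p) (P p) (F p) => a b c d; ring.
Qed.

Lemma homogeneous_char_speed s : fibre_homogeneous Omega 1 (char_speed s).
Proof.
move=> a x y a0 Up; rewrite /char_speed (homogeneous_proj_factor oO hF a0 Up).
by rewrite (homogeneous_F hF a0 Up) mulrDr [X in _ + X]mulrCA.
Qed.

(** Along the ray [F' = 2 P F], and [2 P] is the sum of the two speeds. By [burgers_radial] each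
    speed times its own linear factor is constant, so the derivative of the triple product
    vanishes. *)
Lemma radial_F y S : y != 0 -> 0 <= S -> (forall s, 0 <= s <= S -> Omega (s *: y)) ->
  F (S *: y, y) * ((1 - char_speed mu (0, y) * S) * (1 - char_speed (- mu) (0, y) * S))
  = F (0, y).
Proof.
move=> y0 S0 OS; set a0 := char_speed mu (0, y); set b0 := char_speed (- mu) (0, y).
have bA := burgers_char_speed (erefl (mu ^+ 2)).
have bB := burgers_char_speed (sqrrN mu).
have UU r : 0 <= r <= S -> U (r *: y, y) by move=> /OS.
pose m s := F (s *: y, y) * ((1 - a0 * s) * (1 - b0 * s)).
have linD (c r : R) : is_derive r 1 (fun s => 1 - c * s) (- c).
  have D3 := @is_deriveZ R R R id c r 1 1 (is_derive_id _ _).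
  have D4 := @is_deriveB R R R (fun=> 1) _ r 1 0 _ (is_derive_cst _ _ _) D3.
  by apply: is_derive_eq D4 _; rewrite sub0r /GRing.scale/= mulr1.
have dm r : 0 <= r <= S -> is_derive r 1 m 0.
  move=> rS; have Ur := UU r rS; have D1 := is_derive_radial oO sF Ur.
  have E : 'D_(y, 0) F (r *: y, y) = 2 * (P (r *: y, y) * F (r *: y, y)).
    by rewrite -(hderive_F hF Ur) (hderiveE oO sF Ur).
  rewrite E in D1.
  have D2 := @is_deriveM R R _ _ r 1 _ _ (linD a0 r) (linD b0 r).
  have D3 := @is_deriveM R R _ _ r 1 _ _ D1 D2.
  apply: is_derive_eq D3 _.
  have A := burgers_radial oO bA (@homogeneous_char_speed mu) y0 S0 OS rS.
  have B := burgers_radial oO bB (@homogeneous_char_speed (- mu)) y0 S0 OS rS.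
  move: A B; rewrite -/a0 -/b0 /char_speed.
  move: (P (r *: y, y)) (F (r *: y, y)) => p f A B.
  change (f * ((1 - a0 * r) * (- b0) + (1 - b0 * r) * (- a0)) +
    (1 - a0 * r) * (1 - b0 * r) * (2 * (p * f)) = 0).
  rewrite -[X in _ * (- X) + _]B -[X in _ + _ * (- X)]A; ring.
have SS : 0 <= S <= S by rewrite S0 lexx.
have := @bounded_derivative_estimate R m (fun=> 0) 0 0 0 S.
rewrite !(mul0r, subr0) => H.
have m0 : m 0 = F (0, y) by rewrite /m scale0r !mulr0 subr0 !mulr1.
rewrite -m0 -/(m S); apply/eqP; rewrite -subr_eq0 -normr_le0.
apply: H => r _; rewrite (min_idPl S0) (max_idPr S0) ?subr0 normr0 => rS.
by split => //; exact: dm.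
Qed.

(* The geodesic from the origin is [t |-> rho t *: y]. Its constant speed gives
   [rho' F(rho y, y) = F(0, y)], which [radial_F] turns into an ODE for [rho]. *)
Lemma complete_ray y : forward_complete Omega F -> y != 0 -> Omega 0 ->
  (forall x s, Omega x -> 0 <= s <= 1 -> Omega (s *: x)) ->
  exists rho : R -> R, rho 0 = 0 /\ forall t, 0 <= t ->
    [/\ 0 <= rho t, forall s, 0 <= s <= rho t -> Omega (s *: y) &
     is_derive t 1 rho ((1 - char_speed mu (0, y) * rho t) *
                        (1 - char_speed (- mu) (0, y) * rho t))].
Proof.
move=> fc y0 O0 star; have U0 : U (0, y) by [].
have [d d0 [c0 [gc0 c00 c01]]] := geodesic_through oO hF U0.
have [c cE gc] := fc _ _ gc0.
set J := [set t | _] in gc; have [[_ oJ _] cO dc [s0 s0_gt0 Fc] _] := gc.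
have JP t : 0 <= t -> J t by move=> t0; exists 0 => //=; rewrite normr0.
have J0 : J 0 by exact: JP.
have oI : open [set t : R | `|t| < d] by have [[]] := gc0.
have I0 : [set t : R | `|t| < d] 0 by rewrite /= normr0.
have c_0 : c 0 = 0 by rewrite cE.
have c_1 : derive1 c 0 = y.
  rewrite -c01 !derive1E; apply: near_eq_derive.
  by have := open_nbhs_nbhs (conj oI I0); apply: filterS => t; exact: cE.
have [dc0 _] := dc 0 J0.
have c1n : derive1 c 0 != 0 by rewrite c_1.
have [j yj Hc] := straight_curve oJ J0 dc0 c1n (pflat gc).
have Hc1 s : J s -> derive1 c s = ((derive1 c s) 0 j * (derive1 c 0 0 j)^-1) *: derive1 c 0.
  by move=> Js; exact: derive1_on_line oJ Js (dc s Js).1 Hc.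
rewrite c_1 c_0 in Hc Hc1 yj.
pose rho t := c t 0 j * (y 0 j)^-1.
pose drho t := derive1 c t 0 j * (y 0 j)^-1.
have cr t : J t -> c t = rho t *: y.
  by move=> /Hc ->; rewrite add0r mxE subr0.
have mulcD (f : R -> R) (t df : R) : is_derive t 1 f df ->
    is_derive t 1 (fun t => f t * (y 0 j)^-1) (df * (y 0 j)^-1).
  move=> D; have D2 := @is_deriveM R R f (fun=> (y 0 j)^-1) t 1 _ 0 D (is_derive_cst _ _ _).
  by apply: is_derive_eq D2 _; rewrite scaler0 add0r /GRing.scale/= mulrC.
have dr (t : R) : J t -> is_derive t 1 rho (drho t).
  move=> Jt; apply: mulcD; apply: is_derive_coord.
  by rewrite derive1E; apply: derivableP; exact: (dc t Jt).1.
have drho_cont t : J t -> {for t, continuous drho}.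
  move=> Jt; apply/differentiable_continuous/derivable1_diffP.
  have D := is_derive_coord j (derivableP (dc t Jt).2).
  by have [] := mulcD _ _ _ D.
have rho0 : rho 0 = 0 by rewrite /rho c_0 mxE mul0r.
have drho0 : drho 0 = 1 by rewrite /drho c_1 mulfV.
have F0 x : Omega x -> F (x, 0) = 0.
  by move=> Ox; have [_ /(_ x Ox)[_ _ Fz _ _]] := hF; apply/Fz.
have drho_neq0 t : J t -> drho t != 0.
  move=> Jt; apply/eqP => dt0; have := Fc t Jt.
  rewrite (Hc1 t Jt) -/(drho t) dt0 scale0r F0; last exact: cO.
  by move=> E; rewrite -E ltxx in s0_gt0.
(* The derivative of [rho] is continuous, equals [1] at time [0] and vanishes nowhere since the
   speed is positive, so it keeps its sign. *)
have drho_gt0 t : 0 <= t -> 0 < drho t.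
  move=> t0; rewrite ltNge; apply/negP => dt0.
  have cw : {within `[0, t], continuous drho}.
    apply: continuous_in_subspaceT => s; rewrite inE/= in_itv/= => /andP[s0' _].
    exact/drho_cont/JP.
  have mid : Num.min (drho 0) (drho t) <= 0 <= Num.max (drho 0) (drho t).
    by rewrite drho0 ge_min dt0 orbT le_max ler01.
  have [s] := IVT t0 cw mid; rewrite in_itv/= => /andP[s0' _] ds.
  by have := drho_neq0 s (JP s s0'); rewrite ds eqxx.
have rho_ge0 t : 0 <= t -> 0 <= rho t.
  move=> t0; have [r|r|r] := @MVT_segment R rho drho 0 t t0.
  - by rewrite in_itv/= => /andP[r0 _]; apply/dr/JP/ltW.
  - apply: (@derivable_within_continuous _ _ _ `[0, t]) r => r.
    by rewrite in_itv/= => /andP[r0 _]; have [] := dr r (JP r r0).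
  - rewrite in_itv/= => /andP[r0 _]; rewrite rho0 !subr0 => ->.
    by rewrite mulr_ge0// ltW// drho_gt0.
exists rho; split => // t t0.
(* [s *: y] is [c t] contracted toward the origin, so [star] applies; [rho t = 0] is separate
   because of the division. *)
have ray s : 0 <= s <= rho t -> Omega (s *: y).
  move=> /andP[s0' st]; have [/eqP r0|r0] := boolP (rho t == 0).
    have -> : s = 0 by apply/eqP; rewrite eq_le s0' -r0 st.
    by rewrite scale0r.
  have rt : 0 < rho t by rewrite lt_def r0 rho_ge0.
  have -> : s *: y = (s / rho t) *: c t.
    by rewrite (cr t (JP t t0)) scalerA divfK.
  apply: star; first exact: cO (JP t t0).
  by rewrite divr_ge0 ?(ltW rt)//= ler_pdivrMr// mul1r.
split => //; first exact: rho_ge0.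
have E1 := radial_F y0 (rho_ge0 t t0) ray.
have Ot : Omega (rho t *: y) by apply: ray; rewrite rho_ge0//= lexx.
have speed s : 0 <= s -> Omega (rho s *: y) -> drho s * F (rho s *: y, y) = s0.
  move=> s_ge0 Os; have Us : U (rho s *: y, y) by [].
  have := Fc s (JP s s_ge0); rewrite (Hc1 s (JP s s_ge0)) -/(drho s) (cr s (JP s s_ge0)).
  by rewrite (homogeneous_F hF (drho_gt0 s s_ge0) Us) expr1.
have E2 := speed t t0 Ot.
have E3 : F (0, y) = s0.
  by rewrite -(speed 0 (lexx 0)) rho0 ?scale0r// drho0 mul1r.
have Ft : F (rho t *: y, y) != 0 by rewrite (F_neq0 hF).
apply: is_derive_eq (dr t (JP t t0)) _.
by apply: (mulIf Ft); rewrite E2 -E3 -E1 mulrC.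
Qed.

End FlatMetric.

(** * The blow-up that fixes the curvature *)

Section Rigidity.
Context {R : realType}.

Lemma ray_blow_up (rho : R -> R) (a b a' : R) :
  b <= a -> a < a' -> rho 0 = 0 ->
  (forall t, 0 <= t -> [/\ 0 <= rho t, 0 < 1 - a * rho t, 0 < 1 - a' * rho t &
     is_derive t 1 rho ((1 - a * rho t) * (1 - b * rho t))]) -> False.
Proof.
move=> ba aa' rho0 H; pose w t := (1 - a' * rho t) / (1 - a * rho t).
pose dw t := - (a' - a) * ((1 - b * rho t) / (1 - a * rho t)).
have linD (c t : R) df : is_derive t 1 rho df ->
    is_derive t 1 (fun s => 1 - c * rho s) (- (c * df)).
  move=> D; have D3 := @is_deriveZ R R R rho c t 1 _ D.
  have D4 := @is_deriveB R R R (fun=> 1) _ t 1 0 _ (is_derive_cst _ _ _) D3.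
  by apply: is_derive_eq D4 _; rewrite sub0r.
have dwP (t : R) : 0 <= t -> is_derive t 1 w (dw t).
  move=> /H[r0 ar a'r D]; have an : 1 - a * rho t != 0 by rewrite gt_eqF.
  have D1 := linD a' t _ D; have D2 := linD a t _ D.
  have D3 := @is_deriveV R (fun s => 1 - a * rho s) t _ 1 an D2.
  have D4 := @is_deriveM R R _ _ t 1 _ _ D1 D3.
  apply: is_derive_eq D4 _; rewrite /dw /GRing.scale/=.
  by move: (rho t) an => r an; field.
have a'a : 0 < a' - a by rewrite subr_gt0.
(* Starting from [1] and decreasing at rate at least [a' - a], the function [w] would be at most
   [-1] after this time. *)
pose T := 2 / (a' - a); have T0 : 0 <= T by rewrite divr_ge0// ltW.
have [t|t|t] := @MVT_segment R w dw 0 T T0.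
- by rewrite in_itv/= => /andP[t0 _]; apply/dwP/ltW.
- apply: (@derivable_within_continuous _ _ _ `[0, T]) t => t.
  by rewrite in_itv/= => /andP[t0 _]; have [] := dwP t t0.
rewrite in_itv/= => /andP[t0 _]; rewrite subr0 => E.
have w0 : w 0 = 1 by rewrite /w rho0 !mulr0 !subr0 divr1.
have wT : 0 < w T by have [_ h1 h2 _] := H T T0; rewrite divr_gt0.
have [r0 ar _ _] := H t t0.
have q1 : 1 <= (1 - b * rho t) / (1 - a * rho t).
  by rewrite ler_pdivlMr// mul1r lerD2l lerN2 ler_wpM2r.
have : w T - w 0 <= - 2.
  rewrite E /dw -mulrA mulNr lerN2 mulrCA.
  rewrite [X in _ * X]mulrC /T divfK ?gt_eqF// -[leLHS]mul1r.
  by rewrite ler_wpM2r.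
rewrite w0; lra.
Qed.

End Rigidity.

(** * Uniqueness *)

Section Uniqueness.
Context {R : realType} {n : nat}.
Local Notation V := 'rV[R]_n.
Variables (Omega : set V) (oO : open Omega) (h0 : Omega 0).
Hypothesis star : forall x (s : R), Omega x -> 0 <= s <= 1 -> Omega (s *: x).
Local Notation U := (slit Omega).
Implicit Types (p : V * V) (v w x y z : V) (F : V * V -> R).

Let oU : open U := open_slit oO.

(** The curvature [- mu ^+ 2] is recorded through its scalar consequence for the projective factor,
    from which both Burgers equations follow. *)
Record flat_curvature F (mu : R) : Prop := FlatCurvature {
  flat_finsler : finsler_metric Omega F ;
  flat_projective : projectively_flat Omega F ;
  flat_hderive : forall p, U p -> hderive (proj_factor F) p =
     proj_factor F p ^+ 2 - (- mu ^+ 2) * F p ^+ 2 }.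

Lemma flat_burgers F mu s : flat_curvature F mu -> s ^+ 2 = mu ^+ 2 ->
  burgers Omega (char_speed F s).
Proof. by case=> hF pF cF s2; exact: (burgers_char_speed oO hF pF cF s2). Qed.

(** If [mu1 < mu2], the larger speed of [F2] at [(0, y)] exceeds that of [F1]. Along the ray
    complete for [F1], both positivity conditions of [ray_blow_up] come from [burgers_radial_gt0],
    since both metrics live on the same [Omega]. *)
Lemma curvature_le F1 F2 mu1 mu2 y : flat_curvature F1 mu1 ->
  flat_curvature F2 mu2 -> forward_complete Omega F1 -> 0 <= mu1 -> 0 <= mu2 ->
  y != 0 -> F1 (0, y) = F2 (0, y) ->
  proj_factor F1 (0, y) = proj_factor F2 (0, y) -> mu2 <= mu1.
Proof.
move=> K1 K2 fc m1 m2 y0 Fy Py; rewrite leNgt; apply/negP => m12.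
have [hF1 pF1 cF1] := K1; have [hF2 _ _] := K2.
have U0 : U (0, y) by [].
have [rho [rho0 Hrho]] := complete_ray oO hF1 pF1 cF1 fc y0 h0 star.
have f0 := F_gt0 hF1 U0.
apply: (@ray_blow_up R rho (char_speed F1 mu1 (0, y)) (char_speed F1 (- mu1) (0, y))
  (char_speed F2 mu2 (0, y))) => //.
- by rewrite /char_speed lerD2l ler_wpM2r ?(ltW f0)//; lra.
- by rewrite /char_speed -Py -Fy ltrD2l ltr_pM2r.
move=> t t0; have [r0 ray D] := Hrho t t0; split => //.
- apply: (burgers_radial_gt0 oO (flat_burgers K1 (erefl _))) => //.
  exact: homogeneous_char_speed.
- apply: (burgers_radial_gt0 oO (flat_burgers K2 (erefl _))) => //.
  exact: homogeneous_char_speed.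
Qed.

Lemma char_speed_unique F1 F2 mu s x y : flat_curvature F1 mu ->
  flat_curvature F2 mu ->
  (forall z, F1 (0, z) = F2 (0, z)) ->
  (forall z, proj_factor F1 (0, z) = proj_factor F2 (0, z)) ->
  s ^+ 2 = mu ^+ 2 -> Omega x -> (forall h : R, y + h *: x != 0) ->
  char_speed F1 s (x, y) = char_speed F2 s (x, y).
Proof.
move=> K1 K2 FE PE s2 Ox npar.
apply: (burgers_unique oO (flat_burgers K1 s2) (flat_burgers K2 s2)) => //.
  by move=> t t01; exact: star.
by move=> z; rewrite /char_speed FE PE.
Qed.

(* For [mu = 0] the two speeds coincide and only determine the projective factor;
   [F] is then recovered from a linear ODE along the same characteristic lines. *)
Lemma flat_unique F1 F2 mu x y : flat_curvature F1 mu -> flat_curvature F2 mu ->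
  (forall z, F1 (0, z) = F2 (0, z)) ->
  (forall z, proj_factor F1 (0, z) = proj_factor F2 (0, z)) ->
  Omega x -> (forall h : R, y + h *: x != 0) -> F1 (x, y) = F2 (x, y).
Proof.
move=> K1 K2 FE PE Ox npar.
have E s (s2 : s ^+ 2 = mu ^+ 2) := char_speed_unique K1 K2 FE PE s2 Ox npar.
have [mu0|mu0] := eqVneq mu 0; last first.
  (* The two speeds differ by [2 mu F], so for [mu != 0] they determine [F]. *)
  have := E mu (erefl _); have := E (- mu) (sqrrN mu); rewrite /char_speed.
  move: (proj_factor F1 _) (proj_factor F2 _) (F1 _) (F2 _) => p1 p2 f1 f2 e1 e2.
  have m2 : mu * 2 != 0 by rewrite mulf_neq0// pnatr_eq0.
  by apply: (mulfI m2); lra.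
have [hF1 pF1 cF1] := K1; have [hF2 pF2 cF2] := K2.
have sF1 := smooth_F hF1; have sF2 := smooth_F hF2.
have sP1 := smooth_proj_factor oO hF1; have sP2 := smooth_proj_factor oO hF2.
(* Adding multiples of [x] to [y] keeps it non-parallel to [x], so the projective factors agree on
   this whole two-parameter family; hence their fibre derivatives along [x] agree too. *)
have PP t h : 0 <= t <= 1 ->
    proj_factor F1 (t *: x, y + h *: x) = proj_factor F2 (t *: x, y + h *: x).
  move=> t01; have s2 : 0 ^+ 2 = mu ^+ 2 by rewrite mu0.
  have np k : y + h *: x + k *: (t *: x) != 0.
    by rewrite scalerA -addrA -scalerDl; exact: npar.
  have := char_speed_unique K1 K2 FE PE s2 (star Ox t01) np.
  by rewrite /char_speed !mul0r !addr0.
have i0 : 0 <= (0 : R) <= 1 by rewrite lexx ler01.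
have i1 : 0 <= (1 : R) <= 1 by rewrite lexx ler01.
set c := proj_factor F1 (x, y); pose z := y + c *: x.
have lineE t : char_line x z c t = (t *: x, y + (c - t * c) *: x).
  by rewrite /char_line /z scalerBl addrA.
have Ul t : 0 <= t <= 1 -> U (char_line x z c t).
  by move=> t01; rewrite lineE; split; [exact: star|exact: npar].
have line1 : char_line x z c 1 = (x, y) by rewrite lineE scale1r mul1r subrr scale0r addr0.
have line0 : char_line x z c 0 = (0, z) by rewrite lineE scale0r mul0r subr0.
have bP : burgers Omega (char_speed F1 0) by apply: (flat_burgers K1); rewrite mu0.
have cs p : char_speed F1 0 p = proj_factor F1 p by rewrite /char_speed mul0r addr0.
have Pc t : 0 <= t <= 1 -> proj_factor F1 (char_line x z c t) = c.
  move=> t01; rewrite -cs; apply: (burgers_constant oO bP Ul i1 _ t01).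
  by rewrite cs line1.
have Pc2 t : 0 <= t <= 1 -> proj_factor F2 (char_line x z c t) = c.
  by move=> t01; rewrite lineE -PP// -lineE Pc.
have DP t : 0 <= t <= 1 -> 'D_(0, x) (proj_factor F2) (char_line x z c t) =
    'D_(0, x) (proj_factor F1) (char_line x z c t).
  move=> t01; set p := char_line x z c t.
  have L (f : V * V -> R) (sf : smooth U f) :
     is_derive (0 : R) 1 (fun h => f (p + h *: (0, x))) ('D_(0, x) f p).
    have := @is_derive_line R _ f p (0, x) 0; rewrite scale0r addr0; apply.
    exact: (smooth_derivable sf (Ul t t01)).
  have EE : (fun h : R => proj_factor F2 (p + h *: (0, x))) =
            (fun h : R => proj_factor F1 (p + h *: (0, x))).
    apply/funext => h.
    have -> : p + h *: (0, x) = (t *: x, y + (c - t * c + h) *: x).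
      rewrite /p lineE; apply: injective_projections; rewrite /= ?scaler0 ?addr0//.
      by rewrite -addrA -scalerDl.
    by rewrite PP.
  have [_ e2] := L _ sP2; have [_ e1] := L _ sP1.
  by rewrite -EE in e1; exact: etrans (esym e2) e1.
pose k t := 'D_(0, x) (proj_factor F1) (char_line x z c t).
(* As [P = c] on the line, [F_x - c F_y] reduces to [F P_y]: a linear equation for [F] whose
   coefficient [k] is common to both metrics. *)
have DF F (K : flat_curvature F mu) t : 0 <= t <= 1 ->
    proj_factor F (char_line x z c t) = c ->
    'D_(0, x) (proj_factor F) (char_line x z c t) = k t ->
    is_derive t 1 (fun s => F (char_line x z c s)) (k t * F (char_line x z c t)).
  move=> t01 Fc FD; have [hF pF cF] := K; have Ut := Ul t t01.
  have D := is_derive_char_line oO (smooth_F hF) Ut.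
  apply: is_derive_eq D _.
  have E6 := etrans (derive_base_F oO hF pF x Ut) (derive_fibre_PF oO hF x Ut).
  rewrite Fc FD in E6.
  apply: (etrans (congr1 (fun u => u - c * 'D_(0, x) F (char_line x z c t)) E6)).
  by rewrite addrAC subrr add0r mulrC.
have H t : 0 <= t <= 1 ->
    F1 (char_line x z c t) - F2 (char_line x z c t) = 0.
  move=> t01; move: t t01.
  apply: (@linear_ode_zero R (fun s => F1 (char_line x z c s) - F2 (char_line x z c s))
    k 0 1 0) => //.
  - move=> t t01; have D1 := DF F1 K1 t t01 (Pc t t01) (erefl _).
    have D2 := DF F2 K2 t t01 (Pc2 t t01) (DP t t01).
    have D3 := @is_deriveB R R R _ _ t 1 _ _ D1 D2.
    by apply: is_derive_eq D3 _; rewrite mulrBr.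
  - move=> t t01; apply: (@continuous_char_line _ _ ('D_(0, x) (proj_factor F1))).
    exact: smooth_continuous (smooth_derive (0, x) sP1) (Ul t t01).
  - by rewrite line0 FE subrr.
have := H 1 i1; rewrite line1 => /eqP; rewrite subr_eq0 => /eqP; exact.
Qed.

(** At [x = 0] the second clause is void and the lemma supplies a nonzero vector, which gives the
    theorem a direction for comparing curvatures. *)
Lemma exists_nonparallel x : (2 <= n)%N ->
  exists2 v, v != 0 & forall k : R, x != 0 -> v != k *: x.
Proof.
move=> n2; have [x0|x0] := eqVneq x 0.
  exists (ebase (Ordinal (ltnW n2))) => [|k /eqP//].
  apply/rV0Pn; exists (Ordinal (ltnW n2)).
  by rewrite ebase_coord eqxx oner_eq0.
have [j xj] : exists j, x 0 j != 0 by exact/rV0Pn.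
have [i ij] := exists_neq_ord j n2.
exists (ebase i) => [|k _].
  by apply/rV0Pn; exists i; rewrite ebase_coord eqxx oner_eq0.
apply/eqP => E; have := congr1 (fun w : V => w 0 j) E.
rewrite ebase_coord eq_sym (negbTE ij) mxE => /esym/eqP.
rewrite mulf_eq0 (negbTE xj) orbF => /eqP k0.
have := congr1 (fun w : V => w 0 i) E.
by rewrite ebase_coord eqxx k0 scale0r mxE => /eqP; rewrite oner_eq0.
Qed.

(* As [n >= 2], the vectors that are not parallel to [x] are dense. *)
Lemma eq_nonparallel F1 F2 x : (2 <= n)%N -> finsler_metric Omega F1 ->
  finsler_metric Omega F2 -> Omega x ->
  (forall y, (forall h : R, y + h *: x != 0) -> F1 (x, y) = F2 (x, y)) ->
  (forall z, F1 (0, z) = F2 (0, z)) ->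
  forall y, F1 (x, y) = F2 (x, y).
Proof.
move=> n2 hF1 hF2 Ox H FE y; have [->|y0] := eqVneq y 0.
  have z1 : F1 (x, 0) = 0 by have [_ /(_ x Ox)[_ _ Fz _ _]] := hF1; apply/Fz.
  have z2 : F2 (x, 0) = 0 by have [_ /(_ x Ox)[_ _ Fz _ _]] := hF2; apply/Fz.
  by rewrite z1 z2.
have [->|x0] := eqVneq x 0; first exact: FE.
have [v v0 vx] := exists_nonparallel x n2.
have Uxy : U (x, y) by [].
apply/eqP; rewrite -subr_eq0; apply/negPn/negP => ne.
have e0 : 0 < `|F1 (x, y) - F2 (x, y)| by rewrite normr_gt0.
have sB := smooth_sub oU (smooth_F hF1) (smooth_F hF2).
have /continuous_distP/(_ _ e0)[r r0 Hr] := smooth_continuous sB Uxy.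
have [[h hy]|npar] := pselect (exists h : R, y + h *: x = 0); last first.
  move/eqP: ne; apply; apply/eqP; rewrite subr_eq0; apply/eqP/H => h.
  by apply/eqP => hy; apply: npar; exists h.
pose e := r / 2 / (`|v| + 1).
have v1 : 0 < `|v| + 1 by rewrite ltr_wpDl.
have e_gt0 : 0 < e by rewrite !divr_gt0.
have er : `|(x, y + e *: v) - (x, y)| < r.
  rewrite (_ : _ - _ = (0, e *: v)); last first.
    by apply: injective_projections; rewrite /= ?subrr// addrC addKr.
  rewrite prod_normE/= normr0 gt_max r0 normrZ gtr0_norm//.
  apply: (@le_lt_trans _ _ (r / 2)).
    by rewrite /e mulrAC ler_pdivrMr// ler_wpM2l ?lerDl// divr_ge0// ltW.
  by rewrite ltr_pdivrMr// mulr_natr mulr2n ltrDl.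
have He : F1 (x, y + e *: v) = F2 (x, y + e *: v).
  apply: H => k; apply/eqP => E.
  (* Here [y] is [- h *: x], so a perturbed vector [y + e *: v] parallel to [x] would make [v] the
     multiple [(h - k) / e] of [x]. *)
  have /negP := vx ((h - k) / e) x0; apply; apply/eqP.
  have en : e != 0 by rewrite gt_eqF.
  apply: (scalerI en); rewrite scalerA mulrCA mulfV// mulr1 scalerBl.
  have yE : y = - (h *: x) by apply/eqP; rewrite -addr_eq0 hy.
  by move/eqP: E; rewrite yE addr_eq0 addrC subr_eq => /eqP ->; rewrite addrC.
have := Hr (x, y + e *: v) er.
by rewrite /= He subrr sub0r normrN ltxx.
Qed.

End Uniqueness.

(** Strict convexity speaks of the open segment between distinct points; its two endpoints and the
    degenerate case [x = 0] are treated apart. *)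
Lemma strictly_convex_star (R : realType) (n : nat) (Omega : set 'rV[R]_n) :
  strictly_convex Omega -> Omega 0 ->
  forall (x : 'rV[R]_n) (s : R), Omega x -> 0 <= s <= 1 -> Omega (s *: x).
Proof.
move=> cO O0 x s Ox /andP[s0 s1].
have [->|sn0] := eqVneq s 0; first by rewrite scale0r.
have [->|sn1] := eqVneq s 1; first by rewrite scale1r.
have [->|xn0] := eqVneq x 0; first by rewrite scaler0.
have s01 : 0 < s < 1 by rewrite !lt_def sn0 s0 eq_sym sn1 s1.
have := cO 0 x (subset_closure O0) (subset_closure Ox).
rewrite eq_sym => /(_ xn0 s s01); rewrite scaler0 add0r.
exact: interior_subset.
Qed.

Theorem theorem1p4 (R : realType) (n : nat) (hn : (2 <= n)%N)
  (psi phi : 'rV[R]_n -> R) (Omega : set 'rV[R]_n)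
  (hpsi : minkowski_norm psi) (hphi : pos_homogeneous1 phi)
  (hOpen : open Omega) (hConn : connected Omega)
  (hConv : strictly_convex Omega) (h0 : Omega 0) :
  let admissible (F : 'rV[R]_n * 'rV[R]_n -> R) : Prop :=
    [/\ finsler_metric Omega F,
        forward_complete Omega F,
        projectively_flat Omega F,
        exists2 lambda : R, lambda <= 0 &
          constant_flag_curvature Omega F lambda
      & forall y : 'rV[R]_n,
          psi y = F (0, y) /\ phi y = proj_factor F (0, y)] in
  forall F1 F2 : 'rV[R]_n * 'rV[R]_n -> R,
    admissible F1 -> admissible F2 ->
    forall x y : 'rV[R]_n, Omega x -> F1 (x, y) = F2 (x, y).
Proof.
move=> admissible F1 F2 [hF1 fc1 pf1 [l1 l1_le0 cc1] in1] [hF2 fc2 pf2 [l2 l2_le0 cc2] in2] x y Ox.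
have star := strictly_convex_star hConv h0.
have FE z : F1 (0, z) = F2 (0, z) by rewrite -(in1 z).1 -(in2 z).1.
have PE z : proj_factor F1 (0, z) = proj_factor F2 (0, z).
  by rewrite -(in1 z).2 -(in2 z).2.
(* Nonpositive curvature provides the real number [mu] as the square root of [- lambda]. *)
have sqE l : l <= 0 -> - Num.sqrt (- l) ^+ 2 = l.
  by move=> l0; rewrite sqr_sqrtr ?oppr_ge0// opprK.
have K1 : flat_curvature Omega F1 (Num.sqrt (- l1)).
  split => //; rewrite sqE//.
  exact: (constant_flag_curvature_hderive hOpen hF1 pf1 hn cc1).
have K2 : flat_curvature Omega F2 (Num.sqrt (- l2)).
  split => //; rewrite sqE//.
  exact: (constant_flag_curvature_hderive hOpen hF2 pf2 hn cc2).
have [v v0 _] := exists_nonparallel (0 : 'rV[R]_n) hn.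
(* Both metrics are complete, so the comparison of curvatures runs in both directions. *)
have mu12 : Num.sqrt (- l2) = Num.sqrt (- l1).
  apply/eqP; rewrite eq_le; apply/andP; split.
    exact: (curvature_le hOpen h0 star K1 K2 fc1 (sqrtr_ge0 _) (sqrtr_ge0 _) v0).
  exact: (curvature_le hOpen h0 star K2 K1 fc2 (sqrtr_ge0 _) (sqrtr_ge0 _) v0).
rewrite mu12 in K2.
apply: (eq_nonparallel hOpen hn hF1 hF2 Ox) => // z npar.
exact: (flat_unique hOpen star K1 K2 FE PE Ox npar).
Qed.
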